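(* Let $\Lambda$ be an Artinian ring. Assume that each simple module $S \in \mathsf{mod}\, \Lambda$ satisfies the first non-trivial grade condition: with $j_S := \operatorname{grade} S$, $$\mathrm{Ext}^j_{\Lambda^{op}}(\mathrm{Ext}^{j_S}_\Lambda(S, \Lambda), \Lambda) = 0 \quad \text{for all } j < j_S$$ (this condition being taken to hold vacuously if $j_S = \infty$). Then the first finitistic dimension conjecture holds for $\Lambda^{op}$, i.e. $\operatorname{findim} \Lambda^{op} = \operatorname{Findim} \Lambda^{op}$.
   Context: Artinian means two-sided Artinian. $\mathsf{Mod}\, \Lambda$ is the category of right $\Lambda$-modules, $\mathsf{mod}\, \Lambda$ the full subcategory of finitely presented ones; left modules are identified with modules over $\Lambda^{op}$. For $M \in \mathsf{mod}\,\Lambda$, $\mathrm{Ext}^i_\Lambda(M,\Lambda)$ is a left $\Lambda$-module, and $\operatorname{grade} M := \inf\{ i \geq 0 \mid \mathrm{Ext}^i_\Lambda(M,\Lambda) \neq 0\} \in \mathbb{N}\cup\{\infty\}$. $\operatorname{findim} \Gamma$ (resp. $\operatorname{Findim} \Gamma$) is the supremum of $\operatorname{projdim} M$ over all $M \in \mathsf{mod}\,\Gamma$ (resp. $M \in \mathsf{Mod}\,\Gamma$) of finite projective dimension. *)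

(* Defs.v *)
From HB Require Import structures.
From mathcomp Require Import all_boot all_order all_algebra.
From mathcomp Require Import boolp classical_sets functions cardinality fsbigop.

Set Implicit Arguments.
Unset Strict Implicit.
Unset Printing Implicit Defensive.

Import GRing.Theory.

Local Open Scope quotient_scope.
Local Open Scope classical_set_scope.
Local Open Scope ring_scope.

(* Rings may be zero, so they are [pzRingType]s. An [lmodType A] is a LEFT      *)
(* module over A. A right module over R is a left module over the converse ring *)
(* R^c, which is also the opposite ring of R; [Mod R] below is the category of  *)
(* right R-modules, and left R-modules are the objects of [Mod R^c].            *)
Definition Mod (R : pzRingType) := lmodType R^c.

(* Values in N u {oo} are encoded in [option nat], with [None] for oo. *)

Definition inf_nat (P : set nat) : option nat :=
  match pselect (exists n, `[< P n >]) with
  | left exP => Some (ex_minn exP)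
  | right _ => None
  end.

Definition sup_nat (P : set nat) : option nat :=
  inf_nat [set b | forall n, P n -> (n <= b)%N].

Definition is_zero_module (A : pzRingType) (M : lmodType A) :=
  forall x : M, x = 0.

Section Submodule.
Context {A : pzRingType} {V : lmodType A}.

Record submodule (N : submodClosed V) :=
  Submodule { submodule_val : V; submodule_valP : submodule_val \in N }.

Variable N : submodClosed V.

HB.instance Definition _ := [isSub for @submodule_val N].
HB.instance Definition _ := [Choice of submodule N by <:].
HB.instance Definition _ := [SubChoice_isSubLmodule of submodule N by <:].

End Submodule.

Section Quotient.
Context {A : pzRingType} {V : lmodType A}.

Section ZmodClosed.
Variable N : submodClosed V.
Definition submod_pred : {pred V} := fun x => x \in N.
Fact submod_pred_zmod : zmod_closed submod_pred.
Proof.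
split=> [|x y Nx Ny]; rewrite /submod_pred unfold_in; first exact: rpred0.
by rewrite -scaleN1r; apply: rpredD => //; apply: rpredZ.
Qed.
HB.instance Definition _ := GRing.isZmodClosed.Build V submod_pred submod_pred_zmod.
End ZmodClosed.

Definition quotient_module (N : submodClosed V) : Type :=
  Quotient.quot (submod_pred N).

Variable N : submodClosed V.
Local Notation Q := (quotient_module N).

HB.instance Definition _ := GRing.Zmodule.on Q.

Definition quotient_proj (x : V) : Q := \pi_(Quotient.quot (submod_pred N)) x.

Lemma quotient_projP x y : quotient_proj x = quotient_proj y <-> x - y \in N.
Proof.
rewrite -[x - y \in N]/(x - y \in submod_pred N) Quotient.idealrBE.
by split=> [/eqP|/eqP].
Qed.

Lemma quotient_reprK (u : Q) :
  quotient_proj (repr (u : Quotient.quot (submod_pred N))) = u.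
Proof. exact: reprK. Qed.

Definition quotient_scale (a : A) (u : Q) : Q :=
  quotient_proj (a *: repr (u : Quotient.quot (submod_pred N))).

Lemma quotient_projZ a x :
  quotient_proj (a *: x) = quotient_scale a (quotient_proj x).
Proof.
apply/quotient_projP; rewrite -scalerBr rpredZ //.
by apply/quotient_projP; rewrite quotient_reprK.
Qed.

Lemma quotient_projD x y :
  quotient_proj (x + y) = quotient_proj x + quotient_proj y.
Proof. exact: (raddfD (\pi_(Quotient.quot (submod_pred N)))). Qed.

Lemma quotient_proj0 : quotient_proj 0 = 0.
Proof. exact: (raddf0 (\pi_(Quotient.quot (submod_pred N)))). Qed.

Fact quotient_scalerA a b u :
  quotient_scale a (quotient_scale b u) = quotient_scale (a * b) u.
Proof. by rewrite -[u]quotient_reprK -!quotient_projZ scalerA. Qed.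

Fact quotient_scale1r : left_id 1 quotient_scale.
Proof. by move=> u; rewrite -[u]quotient_reprK -!quotient_projZ scale1r. Qed.

Fact quotient_scalerDr : right_distributive quotient_scale +%R.
Proof.
move=> a u v; rewrite -[u]quotient_reprK -[v]quotient_reprK.
by rewrite -quotient_projD -!quotient_projZ -quotient_projD scalerDr.
Qed.

Fact quotient_scalerDl u : {morph quotient_scale^~ u : a b / a + b}.
Proof.
move=> a b; rewrite -[u]quotient_reprK.
by rewrite -!quotient_projZ -quotient_projD scalerDl.
Qed.

HB.instance Definition _ := GRing.Zmodule_isLmodule.Build A Q
  quotient_scalerA quotient_scale1r quotient_scalerDr quotient_scalerDl.

End Quotient.

Section KernelImage.
Context {A : pzRingType} {U V : lmodType A}.
Variable f : {linear U -> V}.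

Definition ker_pred : {pred U} := fun x => f x == 0.
Fact ker_pred_closed : GRing.subsemimod_closed ker_pred.
Proof.
have E x : (x \in ker_pred) = (f x == 0) by [].
split; first split=> [|x y]; rewrite ?E ?linear0 //.
  by move=> /eqP fx /eqP fy; rewrite linearD fx fy addr0.
by move=> a x; rewrite !E => /eqP fx; rewrite linearZ_LR fx scaler0.
Qed.
HB.instance Definition _ := GRing.isSubmodClosed.Build A U ker_pred ker_pred_closed.
Definition ker : submodClosed U := ker_pred.
Lemma in_ker x : (x \in ker) = (f x == 0). Proof. by []. Qed.

Definition im_pred : {pred V} := fun y => `[< exists x, f x = y >].
Fact im_pred_closed : GRing.subsemimod_closed im_pred.
Proof.
have E x : (x \in im_pred) = `[< exists x', f x' = x >] by [].
split; first split=> [|x y]; rewrite ?E.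
- by apply/asboolP; exists 0; rewrite linear0.
- move=> /asboolP[x' <-] /asboolP[y' <-].
  by apply/asboolP; exists (x' + y'); rewrite linearD.
move=> a x; rewrite !E => /asboolP[x' <-].
by apply/asboolP; exists (a *: x'); rewrite linearZ_LR.
Qed.
HB.instance Definition _ := GRing.isSubmodClosed.Build A V im_pred im_pred_closed.
Definition im : submodClosed V := im_pred.
Lemma in_im y : (y \in im) = `[< exists x, f x = y >]. Proof. by []. Qed.

End KernelImage.

Section Subquotient.
Context {A : pzRingType} {V : lmodType A}.

Definition zero_pred : {pred V} := pred1 0.
Fact zero_pred_closed : GRing.subsemimod_closed zero_pred.
Proof.
have E x : (x \in zero_pred) = (x == 0) by [].
split; first split=> [|x y]; rewrite ?E ?eqxx //.
  by move=> /eqP-> /eqP->; rewrite addr0.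
by move=> a x; rewrite !E => /eqP->; rewrite scaler0.
Qed.
HB.instance Definition _ := GRing.isSubmodClosed.Build A V zero_pred zero_pred_closed.
Definition zero_submod : submodClosed V := zero_pred.

Variables Z B : submodClosed V.

Definition restr_pred : {pred submodule Z} := fun x => val x \in B.
Fact restr_pred_closed : GRing.subsemimod_closed restr_pred.
Proof.
have E x : (x \in restr_pred) = (val x \in B) by [].
split; first split=> [|x y]; rewrite ?E ?raddf0 ?rpred0 //.
  by move=> Bx By; rewrite raddfD rpredD.
by move=> a x; rewrite !E => Bx; rewrite linearZ_LR rpredZ.
Qed.
HB.instance Definition _ :=
  GRing.isSubmodClosed.Build A (submodule Z) restr_pred restr_pred_closed.

Definition restr : submodClosed (submodule Z) := restr_pred.

(* Z / (Z n B), so Z / B when B is contained in Z *)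
Definition subquotient : lmodType A := quotient_module restr.

End Subquotient.
Arguments restr {A V} Z B.

Definition artinian_module (A : pzRingType) (M : lmodType A) :=
  forall I : nat -> submodClosed M,
    (forall n, {subset I n.+1 <= I n}) ->
    exists m, forall n, (m <= n)%N -> I n =i I m.

Definition artinian_ring (R : pzRingType) :=
  artinian_module (R^o : lmodType R) /\ artinian_module ((R^c)^o : lmodType R^c).

Definition simple_module (A : pzRingType) (M : lmodType A) :=
  ~ is_zero_module M /\
  forall N : submodClosed M, N =i zero_submod \/ (forall x, x \in N).

Definition finitely_presented (A : pzRingType) (M : lmodType A) :=
  exists m n (f : {linear 'rV[A]_m -> 'rV[A]_n}) (g : {linear 'rV[A]_n -> M}),
    (forall y, exists x, g x = y) /\ ker g =i im f.

Definition projective (A : pzRingType) (P : lmodType A) :=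
  forall (M N : lmodType A) (g : {linear M -> N}) (f : {linear P -> N}),
    (forall y, exists x, g x = y) ->
    exists h : {linear P -> M}, forall x, g (h x) = f x.

Record proj_resolution (A : pzRingType) (M : lmodType A) := ProjResolution {
  res_mod :> nat -> lmodType A;
  res_d : forall n, {linear res_mod n.+1 -> res_mod n};
  res_aug : {linear res_mod 0%N -> M};
  res_projective : forall n, projective (res_mod n);
  res_exact : forall n, ker (res_d n) =i im (res_d n.+1);
  res_exact_aug : ker res_aug =i im (res_d 0%N);
  res_aug_surj : forall y, exists x, res_aug x = y }.

Definition projdim (A : pzRingType) (M : lmodType A) : option nat :=
  inf_nat [set n | exists P : proj_resolution M,
                     forall i, (n < i)%N -> is_zero_module (P i)].

Section Free.
Context {A : pzRingType}.

Section FreeModule.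
Variable X : choiceType.

Definition finsupp_pred : {pred X -> A^o} :=
  fun f => `[< finite_set [set x | f x != 0] >].
Fact finsupp_pred_closed : GRing.subsemimod_closed finsupp_pred.
Proof.
have E f : (f \in finsupp_pred) = `[< finite_set [set x | f x != 0] >] by [].
split; first split=> [|f g]; rewrite ?E.
- by apply/asboolP; apply: (sub_finite_set _ (finite_set0 X)) => x /=; rewrite eqxx.
- move=> /asboolP ff /asboolP fg; apply/asboolP.
  apply: (@sub_finite_set _ _ ([set x | f x != 0] `|` [set x | g x != 0])).
    move=> x /= fgx; have [fx|] := eqVneq (f x) 0; last by left.
    by right; apply: contraNneq fgx => gx; rewrite -[(f + g) x]/(f x + g x) fx gx addr0.
  by rewrite finite_setU.
- move=> a f; rewrite !E => /asboolP ff; apply/asboolP.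
  apply: sub_finite_set ff => x /=; apply: contraNneq => fx.
  by rewrite -[(a *: f) x]/(a *: f x) fx scaler0.
Qed.
HB.instance Definition _ :=
  GRing.isSubmodClosed.Build A (X -> A^o) finsupp_pred finsupp_pred_closed.

Definition free_module : lmodType A := submodule (finsupp_pred : submodClosed _).

Definition free_coef (u : free_module) (x : X) : A := submodule_val u x.

Fact free_delta_subproof (x : X) :
  (fun y => (y == x)%:R : A^o) \in finsupp_pred.
Proof.
rewrite unfold_in; apply/asboolP.
apply: (sub_finite_set _ (finite_set1 x)) => y /=.
by apply: contraNeq => /negPf ->.
Qed.
Definition free_delta (x : X) : free_module := Submodule (free_delta_subproof x).

Lemma free_supp (u : free_module) :
  exists s : seq X, uniq s /\ forall x, x \notin s -> free_coef u x = 0.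
Proof.
have /asboolP/finite_seqP[s Es] : `[< finite_set [set x | free_coef u x != 0] >].
  exact: (valP u).
exists (undup s); split=> [|x]; first exact: undup_uniq.
rewrite mem_undup; apply: contraNeq => ux.
by have : [set x | free_coef u x != 0] x by []; rewrite Es.
Qed.

Section FreeLift.
Variables (N : lmodType A) (h : X -> N).

Definition free_lift (u : free_module) : N := \sum_(x \in [set: X]) free_coef u x *: h x.

Lemma free_liftE (u : free_module) (s : seq X) : uniq s ->
  (forall x, x \notin s -> free_coef u x = 0) ->
  free_lift u = \sum_(x <- s) free_coef u x *: h x.
Proof.
move=> us su; rewrite /free_lift -(fsbig_widen [set` s]) //.
  by rewrite -fsbig_seq.
by move=> x [_ /= /negP xs]; rewrite /preimage /= su ?scale0r.
Qed.

Fact free_lift_linear : linear free_lift.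
Proof.
move=> a u v.
have [s [_ su]] := free_supp u; have [t [_ tv]] := free_supp v.
pose r := undup (s ++ t).
have ru x : x \notin r -> free_coef u x = 0.
  by rewrite mem_undup mem_cat negb_or => /andP[/su].
have rv x : x \notin r -> free_coef v x = 0.
  by rewrite mem_undup mem_cat negb_or => /andP[_ /tv].
have uE x : free_coef (a *: u + v) x = a * free_coef u x + free_coef v x by [].
have rw x : x \notin r -> free_coef (a *: u + v) x = 0.
  by move=> xr; rewrite uE ru // rv // mulr0 addr0.
rewrite (free_liftE (undup_uniq _) ru) (free_liftE (undup_uniq _) rv).
rewrite (free_liftE (undup_uniq _) rw) scaler_sumr -big_split.
apply: eq_bigr => x _.
by rewrite uE scalerDl scalerA.
Qed.
HB.instance Definition _ :=
  GRing.isLinear.Build A free_module N *:%R free_lift free_lift_linear.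

Lemma free_lift_delta x : free_lift (free_delta x) = h x.
Proof.
rewrite (@free_liftE _ [:: x]) // ?big_seq1 /= ?eqxx ?scale1r //.
by move=> y; rewrite inE /= => /negPf ->.
Qed.

End FreeLift.

Lemma free_decomp (u : free_module) (s : seq X) : uniq s ->
  (forall x, x \notin s -> free_coef u x = 0) ->
  u = \sum_(x <- s) free_coef u x *: free_delta x.
Proof.
move=> us su; apply: val_inj; apply/funext => y.
rewrite -[LHS]/(free_coef u y) -[RHS]/(free_coef _ y).
rewrite (@big_morph _ _ (free_coef^~ y) 0 +%R 0 +%R) //.
have E x : free_coef (free_coef u x *: free_delta x) y =
           free_coef u x * (y == x)%:R by [].
under eq_bigr => x _ do rewrite E.
have [ys|ys] := boolP (y \in s).
  rewrite (bigD1_seq y) //= eqxx mulr1 big1 ?addr0 // => x.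
  by rewrite eq_sym => /negPf ->; rewrite mulr0.
rewrite su // big_seq big1 // => x xs.
by have /negPf -> : y != x; rewrite ?mulr0 //; apply: contraNneq ys => ->.
Qed.

Lemma free_projective : projective free_module.
Proof.
move=> M N g f /choice[k gk].
pose h x := k (f (free_delta x)).
exists (free_lift h : {linear _ -> _}) => u /=.
have [s [us su]] := free_supp u.
rewrite (free_liftE h us su) [in RHS](free_decomp us su) !linear_sum /=.
by apply: eq_bigr => x _; rewrite !linearZ /= gk.
Qed.

End FreeModule.

Variable M : lmodType A.

Definition free_cover (N : lmodType A) : {linear free_module N -> N} :=
  free_lift (id : N -> N).

Fixpoint syzygy (n : nat) : lmodType A :=
  if n is n'.+1 then submodule (ker (free_cover (syzygy n'))) else M.

Definition free_res_mod n : lmodType A := free_module (syzygy n).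

Definition free_res_d n : {linear free_res_mod n.+1 -> free_res_mod n} :=
  (val : syzygy n.+1 -> free_res_mod n) \o free_cover (syzygy n.+1).

Fact free_cover_surj (N : lmodType A) (y : N) : exists x, free_cover N x = y.
Proof. by exists (free_delta y); apply: free_lift_delta. Qed.

Fact free_res_exact_aux n (x : free_res_mod n) :
  (x \in ker (free_cover (syzygy n))) = (x \in im (free_res_d n)).
Proof.
rewrite in_im; apply/idP/asboolP => [kx|[y <-]]; last exact: (valP (free_cover _ y)).
have [y yE] := @free_cover_surj (syzygy n.+1) (Submodule kx).
by exists y; rewrite /= yE.
Qed.

Fact free_res_exact n : ker (free_res_d n) =i im (free_res_d n.+1).
Proof.
move=> x; have <- := @free_res_exact_aux n.+1 x.
suff dE : (free_res_d n x == 0) = (free_cover (syzygy n.+1) x == 0).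
  by rewrite [LHS]in_ker dE.
exact: (inj_eq val_inj (free_cover (syzygy n.+1) x) 0).
Qed.

Definition free_resolution : proj_resolution M :=
  @ProjResolution A M free_res_mod free_res_d (free_cover M)
    (fun n => @free_projective (syzygy n)) free_res_exact
    (@free_res_exact_aux 0) (@free_cover_surj M).

End Free.

Section Dual.
Context {A : pzRingType}.

Section DualModule.
Variable P : lmodType A.

Record dual := Dual { dual_fun :> P -> A; dual_lin : linear (dual_fun : P -> A^o) }.

HB.instance Definition _ := gen_eqMixin dual.
HB.instance Definition _ := gen_choiceMixin dual.

Lemma dual_ext (f g : dual) : f =1 g -> f = g.
Proof.
case: f g => [f lf] [g lg] /= fg; have {}fg : f = g by apply/funext.
by case: _ / fg in lg *; congr Dual; apply: Prop_irrelevance.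
Qed.

Fact dual_zero_subproof : linear ((fun=> 0) : P -> A^o).
Proof. by move=> a x y; rewrite scaler0 addr0. Qed.
Definition dual_zero := Dual dual_zero_subproof.

Fact dual_opp_subproof (f : dual) : linear ((fun x => - f x) : P -> A^o).
Proof. by move=> a x y; rewrite dual_lin opprD scalerN. Qed.
Definition dual_opp f := Dual (dual_opp_subproof f).

Fact dual_add_subproof (f g : dual) : linear ((fun x => f x + g x) : P -> A^o).
Proof. by move=> a x y; rewrite !dual_lin scalerDr addrACA. Qed.
Definition dual_add f g := Dual (dual_add_subproof f g).

Fact dual_scale_subproof (b : A) (f : dual) : linear ((fun x => f x * b) : P -> A^o).
Proof.
move=> a x y; rewrite dual_lin mulrDl; congr (_ + _).
exact: esym (mulrA a (f x) b).
Qed.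
Definition dual_scale b f := Dual (dual_scale_subproof b f).

Fact dual_addA : associative dual_add.
Proof. by move=> f g h; apply: dual_ext => x /=; rewrite addrA. Qed.
Fact dual_addC : commutative dual_add.
Proof. by move=> f g; apply: dual_ext => x /=; rewrite addrC. Qed.
Fact dual_add0 : left_id dual_zero dual_add.
Proof. by move=> f; apply: dual_ext => x /=; rewrite add0r. Qed.
Fact dual_addN : left_inverse dual_zero dual_opp dual_add.
Proof. by move=> f; apply: dual_ext => x /=; rewrite addNr. Qed.
HB.instance Definition _ :=
  GRing.isZmodule.Build dual dual_addA dual_addC dual_add0 dual_addN.

Fact dual_scaleA (a b : A^c) f : dual_scale a (dual_scale b f) = dual_scale (a * b) f.
Proof. by apply: dual_ext => x; apply: esym (mulrA (f x) b a). Qed.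
Fact dual_scale1 : left_id (1 : A^c) dual_scale.
Proof. by move=> f; apply: dual_ext => x; apply: mulr1. Qed.
Fact dual_scaleDr : right_distributive dual_scale +%R.
Proof. by move=> a f g; apply: dual_ext => x; apply: mulrDl. Qed.
Fact dual_scaleDl f : {morph (fun a : A^c => dual_scale a f) : a b / a + b}.
Proof. by move=> a b; apply: dual_ext => x; apply: mulrDr. Qed.

(* Hom_A(P, A) is an A^c-module by (a *: f) x = f x * a, the product being that *)
(* of A.                                                                        *)
HB.instance Definition _ := GRing.Zmodule_isLmodule.Build A^c dual
  dual_scaleA dual_scale1 dual_scaleDr dual_scaleDl.

Lemma dual_funD (f g : dual) x : (f + g) x = f x + g x.
Proof. by []. Qed.

Lemma dual_funZ (a : A^c) (f : dual) x : (a *: f) x = f x * a.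
Proof. by []. Qed.

End DualModule.

Section DualMap.
Variables (P Q : lmodType A) (d : {linear P -> Q}).

Fact dual_map_subproof (f : dual Q) : linear ((fun x => f (d x)) : P -> A^o).
Proof. by move=> a x y; rewrite linearP dual_lin. Qed.
Definition dual_map (f : dual Q) : dual P := Dual (dual_map_subproof f).
Fact dual_map_linear : linear dual_map.
Proof. by move=> a f g; apply: dual_ext. Qed.
HB.instance Definition _ :=
  GRing.isLinear.Build A^c (dual Q) (dual P) *:%R dual_map dual_map_linear.
End DualMap.

Variable M : lmodType A.

Section ExtOfResolution.
Variable P : proj_resolution M.

Definition cocycles i : submodClosed (dual (P i)) := ker (dual_map (res_d P i)).

Definition coboundaries i : submodClosed (dual (P i)) :=
  match i with
  | 0%N => zero_submod
  | i'.+1 => im (dual_map (res_d P i'))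
  end.

Definition ext_res i : lmodType A^c := subquotient (cocycles i) (coboundaries i).
End ExtOfResolution.

(* Ext^i_A(M, A) as a left A^c-module, i.e. a right A-module. For M in [Mod R], *)
(* i.e. A = R^c, it is an object of [Mod R^c], i.e. a left R-module.            *)
Definition Ext i : lmodType A^c := ext_res (free_resolution M) i.

Definition grade : option nat := inf_nat [set i | ~ is_zero_module (Ext i)].

End Dual.

Definition findim (R : pzRingType) : option nat :=
  sup_nat [set n | exists2 M : Mod R, finitely_presented M & projdim M = Some n].

Definition Findim (R : pzRingType) : option nat :=
  sup_nat [set n | exists M : Mod R, projdim M = Some n].

(* Main.v *)
Require Import Defs.
From HB Require Import structures.
From mathcomp Require Import all_boot all_order all_algebra.
From mathcomp Require Import boolp classical_sets.

(** Write A for the converse of Lambda and B for the converse of A, so that right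
    and left Lambda-modules are left A- and B-modules.

    If Ext^i(S, A) = 0 for i < j, dualizing a resolution of the simple A-module S
    by finite free modules yields an exact sequence of B-modules
    0 -> P_0^* -> ... -> P_j^*, whose cokernel has projective dimension exactly j,
    since P_0^* -> P_1^* does not split. So grade S <= findim for all simple S.

    Conversely let j = grade S and E = Ext^j(S, A). By the grade condition
    Hom(S, Ext^j(E, B)) = Hom(E, Ext^j(S, A)), so id_E gives an embedding of S in
    Ext^j(E, B). For n >= j, the n-th syzygy K of any B-module M satisfies
    Ext^(j-1)(E, K) = 0, because Ext^i(E, -) vanishes on projectives for i < j.
    Hence, if 0 -> Q -> P -> K -> 0 is exact with P and Q projective, then
    Ext^j(E, Q) -> Ext^j(E, P) is injective, which forces the coordinates of an
    element of Q lying in rad(B) P to annihilate S. Letting S vary, Q meets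
    rad(B) P in rad(B) Q, so that Q -> P splits modulo the nilpotent radical, hence
    splits, and K is projective. *)

Set Implicit Arguments.
Unset Strict Implicit.
Unset Printing Implicit Defensive.

Import GRing.Theory.

Local Open Scope ring_scope.

(** * Submodules and the radical of an artinian ring *)

Section Submodules.
Context {R : pzRingType}.

Definition is_submod (V : lmodType R) (N : V -> Prop) :=
  [/\ N 0, forall x y, N x -> N y -> N (x + y) & forall a x, N x -> N (a *: x)].

Section IsSubmod.
Context {V : lmodType R} {N : V -> Prop}.
Hypothesis smN : is_submod N.

Lemma submod0 : N 0. Proof. by case: smN. Qed.
Lemma submodD x y : N x -> N y -> N (x + y). Proof. by case: smN => _ h _; apply: h. Qed.
Lemma submodZ a x : N x -> N (a *: x). Proof. by case: smN => _ _ h; apply: h. Qed.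
Lemma submodN x : N x -> N (- x). Proof. by rewrite -scaleN1r; apply: submodZ. Qed.
Lemma submodB x y : N x -> N y -> N (x - y).
Proof. by move=> Nx /submodN; apply: submodD. Qed.
Lemma submodBr x y : N y -> N (x - y) -> N x.
Proof. by move=> Ny /submodD/(_ Ny); rewrite subrK. Qed.

(** The proof of [is_submod N] is an argument so that the canonical structure can be found from the
    predicate. *)
Definition submod_of_pred (_ : is_submod N) : {pred V} := fun x => `[< N x >].
Fact submod_of_closed : GRing.subsemimod_closed (submod_of_pred smN).
Proof.
split; first split=> [|x y]; rewrite ?unfold_in.
- exact/asboolP/submod0.
- by move=> /asboolP Nx /asboolP Ny; apply/asboolP/submodD.
- by move=> a x; rewrite !unfold_in => /asboolP Nx; apply/asboolP/submodZ.
Qed.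
HB.instance Definition _ :=
  GRing.isSubmodClosed.Build R V (submod_of_pred smN) submod_of_closed.
Definition submod_of : submodClosed V := submod_of_pred smN.
Lemma in_submod_of x : x \in submod_of <-> N x.
Proof. by split=> [/asboolP|?]; last exact/asboolP. Qed.
End IsSubmod.

Lemma submodClosedP (V : lmodType R) (N : submodClosed V) :
  is_submod (fun x => x \in N).
Proof.
by split=> [|x y|a x]; [apply: rpred0|apply: rpredD|apply: rpredZ].
Qed.

Lemma is_submodT (V : lmodType R) : is_submod (fun _ : V => True).
Proof. by []. Qed.

Lemma is_submodI (V : lmodType R) (N N' : V -> Prop) :
  is_submod N -> is_submod N' -> is_submod (fun x => N x /\ N' x).
Proof.
move=> sN sN'; split; first by split; apply: submod0.
- by move=> x y [? ?] [? ?]; split; apply: submodD.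
- by move=> a x [? ?]; split; apply: submodZ.
Qed.

Lemma is_submod_add (V : lmodType R) (N N' : V -> Prop) :
  is_submod N -> is_submod N' -> is_submod (fun x => exists2 y, N y & N' (x - y)).
Proof.
move=> sN sN'; split; first by exists 0; rewrite ?subr0; apply: submod0.
- move=> x y [u Nu xu] [v Nv yv]; exists (u + v); first exact: submodD.
  by rewrite opprD addrACA; apply: submodD.
- by move=> a x [u Nu xu]; exists (a *: u); rewrite -?scalerBr; apply: submodZ.
Qed.

Lemma is_submod_cycle (V : lmodType R) (v : V) : is_submod (fun x => exists a, x = a *: v).
Proof.
split; first by exists 0; rewrite scale0r.
- by move=> x y [a ->] [b ->]; exists (a + b); rewrite scalerDl.
- by move=> a x [b ->]; exists (a * b); rewrite scalerA.
Qed.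

Lemma is_submod_preim (U V : lmodType R) (f : {linear U -> V}) (N : V -> Prop) :
  is_submod N -> is_submod (fun x => N (f x)).
Proof.
move=> sN; split; first by rewrite linear0; apply: submod0.
- by move=> x y Nx Ny; rewrite linearD; apply: submodD.
- by move=> a x Nx; rewrite linearZ_LR; apply: submodZ.
Qed.

Lemma is_submod_image (U V : lmodType R) (f : {linear U -> V}) (N : U -> Prop) :
  is_submod N -> is_submod (fun y => exists2 x, N x & f x = y).
Proof.
move=> sN; split; first by exists 0; [apply: submod0|rewrite linear0].
- move=> _ _ [x Nx <-] [y Ny <-].
  by exists (x + y); [apply: submodD|rewrite linearD].
- by move=> a _ [x Nx <-]; exists (a *: x); [apply: submodZ|rewrite linearZ_LR].
Qed.

Inductive span (V : lmodType R) (G : V -> Prop) : V -> Prop :=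
| span_mem x of G x : span G x
| span0 : span G 0
| spanD x y of span G x & span G y : span G (x + y)
| spanZ a x of span G x : span G (a *: x).

Lemma span_submod (V : lmodType R) (G : V -> Prop) : is_submod (span G).
Proof. by split; [apply: span0|apply: spanD|apply: spanZ]. Qed.

Lemma span_sub (V : lmodType R) (G N : V -> Prop) :
  is_submod N -> (forall x, G x -> N x) -> forall x, span G x -> N x.
Proof.
move=> sN GN x; elim=> [y /GN //||y z _ Ny _ Nz|a y _ Ny].
- exact: submod0.
- exact: submodD.
- exact: submodZ.
Qed.

(** Otherwise every candidate contains a strictly smaller one, and iterating a choice of these gives
    a chain that never becomes stationary. *)
Lemma artinian_minimal (M : lmodType R) : artinian_module M ->
  forall Q : (M -> Prop) -> Prop, (exists2 N, is_submod N & Q N) ->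
  exists N, [/\ is_submod N, Q N & forall N', is_submod N' -> Q N' ->
    (forall x, N' x -> N x) -> forall x, N x -> N' x].
Proof.
move=> artM Q [N0 sN0 QN0]; apply: contrapT => nomin.
pose T := {N | is_submod N /\ Q N}.
have step (N : T) : exists N' : T,
    (forall x, sval N' x -> sval N x) /\ exists2 x, sval N x & ~ sval N' x.
  apply: contrapT => noN'; case: N => N [sN QN] /= in noN'.
  apply: nomin; exists N; split=> // N' sN' QN' N'N x Nx.
  apply: contrapT => N'x; apply: noN'.
  by exists (exist _ N' (conj sN' QN')) => /=; split=> //; exists x.
have [f fP] := choice step.
pose C n := iter n f (exist _ N0 (conj sN0 QN0)).
pose I n : submodClosed M := submod_of (proj1 (svalP (C n))).
have dec n : {subset I n.+1 <= I n}.
  by move=> x /in_submod_of /= /(proj1 (fP (C n))) ?; apply/in_submod_of.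
have [m mP] := artM I dec.
have [x Cx nCx] := proj2 (fP (C m)); apply: nCx.
apply/(in_submod_of (proj1 (svalP (C m.+1)))); change (x \in I m.+1).
by rewrite (mP m.+1) //; apply/in_submod_of.
Qed.

End Submodules.

(** * The Jacobson radical *)

Section Jacobson.
Context {R : pzRingType}.

Definition rad (a : R) : Prop := forall b : R, exists u : R, u * (1 - b * a) = 1.

Lemma rad_submod : is_submod (V := R^o) rad.
Proof.
split=> [b|x y xJ yJ b|a x xJ b].
- by exists 1; rewrite mulr0 subr0 mulr1.
- have [u uP] := xJ b; have [v vP] := yJ (u * b); exists (v * u).
  by rewrite -mulrA [b * _]mulrDr opprD addrA [u * _]mulrDr uP mulrN mulrA.
- by have [u uP] := xJ (b * a); exists u; rewrite -[a *: x]/(a * x) mulrA.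
Qed.

Lemma rad_inv a : rad a -> exists u : R, u * (1 - a) = 1.
Proof. by move=> /(_ 1); rewrite mul1r. Qed.

Lemma radMl a (x : R) : rad x -> rad (a * x).
Proof. exact: (submodZ rad_submod). Qed.

(** From [u * (1 - c * b * x) = 1] one gets the left inverse [1 + b * x * u * c] of
    [1 - b * (x * c)]. *)
Lemma radMr (x c : R) : rad x -> rad (x * c).
Proof.
move=> xJ b; have [u uP] := xJ (c * b); exists (1 + b * x * u * c).
have K : b * x * u * c * (1 - b * (x * c)) = b * x * (u * (1 - c * b * x)) * c.
  by rewrite !mulrBr !mulr1 mulrBl !mulrA.
by rewrite mulrDl mul1r K uP mulr1 mulrA subrK.
Qed.

(** The left inverse [u] equals [1 - (- u) * a], so it is itself left invertible; hence [u] is a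
    unit with inverse [1 - a]. *)
Lemma rad_unit a : rad a -> exists u : R, u * (1 - a) = 1 /\ (1 - a) * u = 1.
Proof.
move=> aJ; have [u uP] := rad_inv aJ; exists u; split=> //.
have [v vP] := aJ (- u).
have E : u = 1 - - u * a.
  by move/eqP: uP; rewrite mulNr opprK mulrBr mulr1 subr_eq => /eqP.
move: vP; rewrite -E => vu.
have <- : v = 1 - a by rewrite -[RHS]mul1r -{1}vu -mulrA uP mulr1.
exact: vu.
Qed.

(** The class of [e] is zero or generates a simple left submodule of [R / rad R]. *)
Definition rad_min (e : R) :=
  forall a : R, rad (a * e) \/ exists b : R, rad (b * a * e - e).

Hypothesis artR : artinian_module (R^o : lmodType R).

(* A left ideal I minimal with 1 \in I + (sum of the minimal elements) lies in
   the radical: otherwise it contains some minimal e, and 1 - b e is not left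
   invertible for some b, so that I can be cut down to I \cap R (1 - b e). *)
Lemma rad_min_span : exists2 x : R, span (V := R^o) rad_min x & rad (1 - x).
Proof.
pose Sg := span (V := R^o) rad_min.
have sSg : is_submod Sg := span_submod _.
have [|I [sI [x Ix Sx] Imin]] :=
  artinian_minimal artR (Q := fun I => exists2 x, I x & Sg (1 - x)).
  exists (fun _ => True); first exact: is_submodT.
  by exists 1 => //; rewrite subrr; apply: submod0.
have [IJ|] := pselect (forall y, I y -> rad y).
  by exists (1 - x) => //; rewrite subKr; apply: IJ.
move=> /existsNP[y /not_implyP[Iy nJy]]; exfalso.
have [|I0 [sI0 [I0I [e I0e nJe]] I0min]] := artinian_minimal artR
    (Q := fun I0 => (forall z, I0 z -> I z) /\ exists2 z, I0 z & ~ rad z).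
  by exists I => //; split=> //; exists y.
have mine : rad_min e.
  move=> a; have [|nJ] := pselect (rad (a * e)); [by left|right].
  have [|||b /= eE] := I0min (fun z => exists b : R, z = b *: (a * e : R^o)) _ _ _ e I0e.
  - exact: is_submod_cycle.
  - split=> [z [b ->]|]; first by apply/(submodZ sI)/(submodZ sI)/I0I.
    by exists (a * e) => //; exists 1; rewrite scale1r.
  - by move=> z [b ->]; do 2! apply: (submodZ sI0).
  - exists b; suff -> : b * a * e - e = 0 by apply: submod0 rad_submod.
    by rewrite [X in _ - X]eE -mulrA subrr.
have /existsNP[b nb] : ~ rad e := nJe.
have Ie : I e by apply: I0I.
have [|||_ [r eE]] := Imin (fun z => I z /\ exists r : R, z = r *: (1 - b * e : R^o)) _ _ _ e Ie.
- exact: is_submodI sI (is_submod_cycle _).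
- have xE : x * (1 - b * e) = x - x * b * e by rewrite mulrBr mulr1 mulrA.
  exists (x * (1 - b * e)).
    split; last by exists x.
    by rewrite xE; apply: (submodB sI) => //; apply: (submodZ sI).
  rewrite xE opprB addrCA; apply: submodD => //.
  by apply: (submodZ sSg); apply: span_mem.
- by move=> z [].
apply: nb; exists (b * r + 1).
by rewrite mulrDl mul1r -mulrA -[r * _]/(r *: (1 - b * e : R^o)) -eE addrC subrK.
Qed.

(** By [rad_min_span], 1 is modulo the radical a combination of such [e]; if every [e *: v] were in
    [T], so would be [v]. *)
Lemma exists_rad_min (V : lmodType R) (T : V -> Prop) (v : V) : is_submod T ->
  (forall j, rad j -> T (j *: v)) -> ~ T v -> exists2 e, rad_min e & ~ T (e *: v).
Proof.
move=> sT JT nTv; apply: contrapT => noe; apply: nTv.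
have [x xS xJ] := rad_min_span.
rewrite -[v]scale1r -(subrK x 1) scalerDl; apply: submodD => //; first exact: JT.
elim: xS => [e me||y z _ Ty _ Tz|a y _ Ty].
- by apply: contrapT => nT; apply: noe; exists e.
- by rewrite scale0r; apply: submod0.
- by rewrite scalerDl; apply: submodD.
- by rewrite -scalerA; apply: submodZ.
Qed.

Definition seq_prod (s : seq R) : R := \prod_(x <- s) x.

(** Let J be the radical and J^m its smallest power. If J^m is nonzero, take a left ideal [I]
    minimal with J^m I nonzero. As J^m = J^(m+1), [I] is generated by some [j * x] with [j] in J and
    [x] in [I]; then [x = r * j * x], and [x = 0] because [1 - r * j] is left invertible. *)
Lemma rad_nilpotent : exists n, forall s : seq R,
  size s = n -> (forall x, x \in s -> rad x) -> seq_prod s = 0.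
Proof.
pose G n (x : R^o) := exists s : seq R,
  [/\ size s = n, (forall x, x \in s -> rad x) & x = seq_prod s].
pose P n := span (G n).
have PS n x : P n.+1 x -> P n x.
  apply: span_sub => [|_ [s [ss sJ ->]]]; first exact: span_submod.
  case: s => [|a s] // in ss sJ *; case: ss => ss.
  rewrite /seq_prod big_cons; apply: (@submodZ R R^o _ (span_submod (G n)) a (\prod_(y <- s) y)).
  by apply: span_mem; exists s; split=> // y ys; apply: sJ; rewrite inE ys orbT.
have [|N [sN [m Nm] Nmin]] := artinian_minimal artR
    (Q := fun N => exists m, N = P m).
  by exists (P 0%N); [apply: span_submod|exists 0%N].
subst N; exists m => s0 s0m s0J; apply: contrapT => s0N.
have [|I [sI [x Ix [d [Pd dx]]] Imin]] := artinian_minimal artR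
    (Q := fun I => exists2 x, I x & exists d : R, P m d /\ d * x <> 0).
  exists (fun _ => True); first exact: is_submodT.
  exists 1 => //; exists (seq_prod s0); split; last by rewrite mulr1.
  by apply: span_mem; exists s0.
have [j [d' [jJ Pd' dN]]] : exists j d' : R, [/\ rad j, P m d' & d' * j * x <> 0].
  have := Nmin (P m.+1) (span_submod _) (ex_intro _ _ erefl) (PS m) d Pd.
  move=> Pd1; apply: contrapT => no; apply: dx.
  apply: (@span_sub R R^o _ (fun c : R => c * x = 0) _ _ d Pd1).
    split; first exact: mul0r.
    - by move=> y z Ey Ez; rewrite mulrDl Ey Ez addr0.
    - by move=> a y Ey; rewrite -[a *: y]/(a * y) -mulrA Ey mulr0.
  move=> _ [s [ss sJ ->]]; apply: contrapT => sN0; apply: no.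
  case/lastP: s => // s j in ss sJ sN0 *.
  exists j, (seq_prod s); split.
  - by apply: sJ; rewrite mem_rcons inE eqxx.
  - apply: span_mem; exists s; split=> // [|y ys].
      by move: ss; rewrite size_rcons => -[].
    by apply: sJ; rewrite mem_rcons inE ys orbT.
  - by move: sN0; rewrite /seq_prod -cats1 big_cat /= big_seq1.
have [|||r xE] := Imin (fun z => exists r : R, z = r *: (j * x : R^o)) _ _ _ x Ix.
- exact: is_submod_cycle.
- exists (j * x); first by exists 1; rewrite scale1r.
  by exists d'; split=> //; rewrite mulrA.
- by move=> z [r ->]; do 2! apply: (submodZ sI).
have [u uP] := rad_inv (radMl r jJ).
have x0 : (1 - r * j) * x = 0.
  by rewrite mulrBl mul1r {1}xE -[r *: _]/(r * (j * x)) mulrA subrr.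
by apply: dx; rewrite -[x]mul1r -uP -mulrA x0 !mulr0.
Qed.

(** [N / W] is killed by the radical, hence semisimple, and [U / W] is a complement of the image of
    [D]. Zorn's lemma gives a maximal [U]; if [D + U] missed [v], it would miss some [e *: v] with
    [rad_min e], and adding the multiples of [e *: v] would enlarge [U]. *)
Lemma complement_mod_rad (V : lmodType R) (N W D : V -> Prop) :
  is_submod N -> is_submod W -> is_submod D ->
  (forall x, W x -> N x) -> (forall x, D x -> N x) ->
  (forall j x, rad j -> N x -> W (j *: x)) ->
  exists U, [/\ is_submod U, forall x, W x -> U x, forall x, U x -> N x,
    forall x, U x -> D x -> W x &
    forall x, N x -> exists2 d, D d & U (x - d)].
Proof.
move=> sN sW sD WN DN JNW.
pose good (U : V -> Prop) := [/\ is_submod U, forall x, W x -> U x,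
  forall x, U x -> N x & forall x, U x -> D x -> W x].
(* the empty set is added so that unions of all chains are allowed *)
pose Q (U : set V) := U = set0 \/ good U.
have [|U [QU Umax]] := @Zorn_bigcup V Q.
  move=> F FQ Ftot.
  have [[U0 [FU0 [sU0 WU0 _ _]]]|nogood] := pselect (exists U, F U /\ good U); last first.
    left; apply/seteqP; split=> // x [X FX Xx].
    have [X0|gX] := FQ X FX; first by rewrite X0 in Xx.
    by case: nogood; exists X.
  right; split.
  - split; first by exists U0 => //; apply: submod0.
    + move=> x y [X FX Xx] [Y FY Yy].
      have [X0|[sX _ _ _]] := FQ X FX; first by rewrite X0 in Xx.
      have [Y0|[sY _ _ _]] := FQ Y FY; first by rewrite Y0 in Yy.
      have [XY|YX] := Ftot _ _ FX FY.
        by exists Y => //; apply: submodD => //; apply: XY.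
      by exists X => //; apply: submodD => //; apply: YX.
    + move=> a x [X FX Xx]; exists X => //.
      have [X0|[sX _ _ _]] := FQ X FX; first by rewrite X0 in Xx.
      exact: submodZ.
  - by move=> x Wx; exists U0 => //; apply: WU0.
  - move=> x [X FX Xx].
    by have [X0|[_ _ XN _]] := FQ X FX; [rewrite X0 in Xx|apply: XN].
  - move=> x [X FX Xx].
    by have [X0|[_ _ _ XW]] := FQ X FX; [rewrite X0 in Xx|apply: XW].
have gW : good W by split.
have gU : good U.
  case: QU => // U0; exfalso; apply: (Umax W); last by right.
  rewrite U0; split=> // /(_ 0); apply; exact: (submod0 sW).
have [sU WU UN UD] := gU; exists U; split=> // v Nv; apply: contrapT => nv.
pose T x := exists2 d, D d & U (x - d).
have sT : is_submod T by apply: is_submod_add.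
have UT x : U x -> T x.
  by move=> Ux; exists 0; [apply: submod0|rewrite subr0].
have [|e me nTe] := exists_rad_min sT _ nv.
  by move=> j jJ; apply/UT/WU/JNW.
pose U' x := exists2 u, U u & exists a, x - u = a *: (e *: v).
have UU' x : U x -> U' x by move=> Ux; exists x => //; exists 0; rewrite subrr scale0r.
apply: (Umax U').
  split=> [x /UU' //|U'U]; apply: nTe; apply/UT/U'U.
  by exists 0; [apply: submod0|exists 1; rewrite subr0 scale1r].
right; split.
- exact: (is_submod_add sU (is_submod_cycle (e *: v))).
- by move=> x /WU/UU'.
- move=> x [u Uu [a xE]]; apply: (submodBr sN (UN _ Uu)); rewrite xE.
  by do 2! apply: (submodZ sN).
- move=> x [u Uu [a xE]] Dx.
  have Taev : T (a *: (e *: v)).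
    by exists x => //; rewrite -xE addrAC subrr add0r; apply: (submodN sU).
  apply: UD => //; apply: (submodBr sU Uu); rewrite xE.
  have [aeJ|[b bJ]] := me a; first by apply: WU; rewrite scalerA; apply: JNW.
  exfalso; apply: nTe; rewrite -[e *: v](subKr (b *: (a *: (e *: v)))).
  apply: (submodB sT); first exact: (submodZ sT).
  by rewrite !scalerA -scalerBl; apply/UT/WU/JNW.
Qed.

End Jacobson.

(** * Finiteness conditions *)

Section Linear.
Context {R : pzRingType}.

Definition linear_of (U V : lmodType R) (f : U -> V) (lf : linear f) : {linear U -> V} :=
  HB.pack f (GRing.isLinear.Build R U V *:%R f lf).

Lemma factor_surj (P M N : lmodType R) (p : {linear P -> M}) (f : {linear P -> N}) :
  (forall y, exists x, p x = y) -> (forall x, p x = 0 -> f x = 0) ->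
  exists g : {linear M -> N}, forall x, g (p x) = f x.
Proof.
move=> /choice[s sK] pf.
have fs x : f (s (p x)) = f x.
  by apply/subr0_eq; rewrite -linearB pf // linearB /= sK subrr.
have lg : linear (fun y => f (s y)).
  by move=> a x y; rewrite -linearP -[RHS]fs [p _]linearP /= !sK.
by exists (linear_of lg).
Qed.

Lemma factor_inj (K P N : lmodType R) (i : {linear K -> P}) (f : {linear N -> P}) :
  (forall k, i k = 0 -> k = 0) -> (forall x, exists k, i k = f x) ->
  exists g : {linear N -> K}, forall x, i (g x) = f x.
Proof.
move=> i0 /choice[g gP].
have lg : linear g.
  by move=> a x y; apply/subr0_eq/i0; rewrite linearB linearP !gP linearP subrr.
by exists (linear_of lg).
Qed.

Lemma projective_retract (P M : lmodType R) (r : {linear P -> M}) (s : {linear M -> P}) :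
  projective P -> (forall x, r (s x) = x) -> projective M.
Proof.
move=> pP rs U V g f gS; have [h hP] := pP _ _ g (f \o r) gS.
by exists (h \o s) => x; rewrite /= hP /= rs.
Qed.

(** Here [g] need not be surjective: both maps are corestricted to [im g]. *)
Lemma projective_lift (Q U V : lmodType R) (f : {linear Q -> V}) (g : {linear U -> V}) :
  projective Q -> (forall q, exists u, g u = f q) ->
  exists h : {linear Q -> U}, forall q, g (h q) = f q.
Proof.
move=> pQ fg; pose W := submodule (im g).
have v0 (x : W) : val x = 0 -> x = 0 by move=> x0; apply: val_inj; rewrite x0 raddf0.
have mW v : (exists u, g u = v) -> exists x : W, val x = v.
  move=> gv; have vW : v \in im g by rewrite in_im; apply/asboolP.
  by exists (Submodule vW).
have [u|g' g'P] := @factor_inj _ _ _ (val : W -> V) g v0; first by apply: mW; exists u.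
have [q|f' f'P] := @factor_inj _ _ _ (val : W -> V) f v0; first exact/mW/fg.
have [|h hP] := pQ _ _ g' f'.
  move=> x; have := valP x; rewrite in_im => /asboolP[u gu].
  by exists u; apply: val_inj; rewrite g'P.
by exists h => q; rewrite -g'P hP f'P.
Qed.

Definition row_comb n (V : lmodType R) (v : 'I_n -> V) (u : 'rV[R]_n) : V :=
  \sum_i u 0 i *: v i.
Lemma row_comb_linear n (V : lmodType R) (v : 'I_n -> V) : linear (row_comb v).
Proof.
move=> a x y; rewrite /row_comb scaler_sumr -big_split; apply: eq_bigr => i _.
by rewrite !mxE scalerDl scalerA.
Qed.

Lemma row_combE n (V : lmodType R) (f : {linear 'rV[R]_n -> V}) u :
  f u = row_comb (fun i => f (delta_mx 0 i)) u.
Proof.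
rewrite {1}[u]row_sum_delta linear_sum; apply: eq_bigr => i _.
by rewrite linearZ_LR.
Qed.

Lemma row_comb_delta n (V : lmodType R) (v : 'I_n -> V) i :
  row_comb v (delta_mx 0 i) = v i.
Proof.
rewrite /row_comb (bigD1 i) //= mxE !eqxx scale1r big1 ?addr0 // => k ki.
by rewrite mxE (negPf ki) andbF scale0r.
Qed.

Lemma row_projective n : projective ('rV[R]_n : lmodType R).
Proof.
move=> U V g f /choice[s sK].
exists (linear_of (row_comb_linear (fun i => s (f (delta_mx 0 i))))) => x /=.
rewrite linear_sum [RHS]row_combE; apply: eq_bigr => i _.
by rewrite linearZ_LR sK.
Qed.

Lemma projective_section (N : lmodType R) : projective N ->
  exists s : {linear N -> free_module N}, forall x, free_cover N (s x) = x.
Proof.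
move=> pN; have [h hP] := pN _ _ (free_cover N) idfun (@free_cover_surj R N).
by exists h => x; rewrite hP.
Qed.

Definition fg (M : lmodType R) :=
  exists n (g : {linear 'rV[R]_n -> M}), forall y, exists x, g x = y.

Definition fg_submod (V : lmodType R) (N : V -> Prop) :=
  exists2 t : seq V, (forall x, x \in t -> N x) &
    forall x, N x -> span (fun y => y \in t) x.

Lemma span_incl (V : lmodType R) (G G' : V -> Prop) x :
  (forall y, G y -> G' y) -> span G x -> span G' x.
Proof. by move=> GG'; apply: span_sub (span_submod _) _ _ => y /GG'; apply: span_mem. Qed.

Lemma fg_submod_mod (V : lmodType R) (N W : V -> Prop) (t : seq V) :
  is_submod N -> (forall x, x \in t -> N x) ->
  (forall x, N x -> exists2 y, span (fun z => z \in t) y & W (x - y)) ->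
  fg_submod (fun x => N x /\ W x) -> fg_submod N.
Proof.
move=> sN tN tW [t' t'N t'W]; exists (t ++ t') => [x|x Nx].
  by rewrite mem_cat => /orP[/tN //|/t'N[]].
have [y ty Wxy] := tW x Nx; have Ny : N y by apply: span_sub ty.
rewrite -(subrK y x); apply: spanD.
- apply: (@span_incl _ (fun z => z \in t')) => [z zt|]; first by rewrite mem_cat zt orbT.
  by apply: t'W; split=> //; apply: submodB.
- by apply: (span_incl _ ty) => z zt; rewrite mem_cat zt.
Qed.

Lemma span_fg (M : lmodType R) (t : seq M) :
  (forall x, span (fun y => y \in t) x) -> fg M.
Proof.
move=> tM; exists (size t).
pose g := linear_of (row_comb_linear (fun i : 'I_(size t) => t`_i)); exists g => y.
have sI := is_submod_image g (is_submodT _).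
have [z zt|x _ <-] := span_sub sI _ (tM y); last by exists x.
move: (zt); rewrite -index_mem => lt_zt.
exists (delta_mx 0 (Ordinal lt_zt)) => //=.
by rewrite row_comb_delta /= nth_index.
Qed.

Lemma fg_submodule (V : lmodType R) (N : submodClosed V) :
  fg_submod (fun x => x \in N) -> fg (submodule N).
Proof.
move=> [t tN Nt]; apply: (@span_fg _ (pmap insub t)) => x.
suff [z [zx zt]] : exists z : submodule N, val z = val x /\
    span (fun y => y \in pmap insub t) z by rewrite -(val_inj zx).
elim: (Nt _ (valP x)) => [y yt||y z _ [y' [<- ty']] _ [z' [<- tz']]|a y _ [y' [<- ty']]].
- exists (Submodule (tN y yt)); split=> //; apply: span_mem.
  by rewrite mem_pmap_sub.
- by exists 0; split; [rewrite raddf0|apply: span0].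
- by exists (y' + z'); split; [rewrite raddfD|apply: spanD].
- by exists (a *: y'); split; [rewrite linearZ_LR|apply: spanZ].
Qed.

Lemma fg_surj (U V : lmodType R) (f : {linear U -> V}) :
  (forall y, exists x, f x = y) -> fg U -> fg V.
Proof.
move=> fS [n [g gS]]; exists n, (f \o g) => y.
by have [x <-] := fS y; have [z <-] := gS x; exists z.
Qed.

Lemma fg_row n : fg ('rV[R]_n : lmodType R).
Proof. by exists n, idfun => y; exists y. Qed.

(** Stated for all [R^n], the form needed for kernels of finite free covers. *)
Definition noetherian := forall n (N : submodClosed 'rV[R]_n), fg (submodule N).

(** The preimage of [K] under a finite free cover of [M] is finitely generated and maps onto [K]. *)
Lemma noetherian_inj (K M : lmodType R) (i : {linear K -> M}) : noetherian ->
  (forall k, i k = 0 -> k = 0) -> fg M -> fg K.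
Proof.
move=> nR i0 [n [g gS]].
have sN : is_submod (fun u => exists2 k, True & i k = g u).
  exact: is_submod_preim g _ (is_submod_image i (is_submodT _)).
have [|h hP] := @factor_inj _ _ _ i (g \o (val : submodule (submod_of sN) -> _)) i0.
  by move=> u; have [k _ ik] := (in_submod_of sN _).1 (valP u); exists k.
apply: (@fg_surj _ _ h) (nR _ (submod_of sN)) => k.
have [u gu] := gS (i k).
have uN : u \in submod_of sN by apply/in_submod_of; exists k.
exists (Submodule uN); apply/subr0_eq/i0.
by rewrite linearB hP /= gu subrr.
Qed.

Lemma noetherian_fp (M : lmodType R) : noetherian -> fg M -> finitely_presented M.
Proof.
move=> nR [n [g gS]]; have [m [f fS]] := nR n (ker g).
exists m, n, (val \o f), g; split=> // x; rewrite in_im in_ker.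
apply/eqP/asboolP => [gx|[u <-]]; last by apply/eqP; rewrite -in_ker; apply: valP.
have xN : x \in ker g by rewrite in_ker gx.
by have [u fu] := fS (Submodule xN); exists u; rewrite /= fu.
Qed.

Fixpoint rad_pow n (V : lmodType R) : V -> Prop :=
  if n is n'.+1 then span (fun x => exists j y, [/\ rad j, rad_pow n' y & x = j *: y])
  else fun _ => True.

Lemma rad_pow_submod n (V : lmodType R) : is_submod (@rad_pow n V).
Proof. by case: n => [|n]; [apply: is_submodT|apply: span_submod]. Qed.

Lemma rad_pow_scale n (V : lmodType R) j (x : V) :
  rad j -> rad_pow n x -> rad_pow n.+1 (j *: x).
Proof. by move=> jJ xn; apply: span_mem; exists j, x. Qed.

Lemma rad_pow_map n (U V : lmodType R) (f : {linear U -> V}) k :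
  (forall x, rad_pow k (f x)) -> forall x, rad_pow n x -> rad_pow (n + k) (f x).
Proof.
move=> fk; elim: n => [|n IH] x; first by move=> _; apply: fk.
apply: (span_sub (is_submod_preim f (rad_pow_submod (n + k).+1 V))).
move=> _ [j [y [jJ /IH yn ->]]]; rewrite linearZ_LR.
exact: rad_pow_scale.
Qed.

Hypothesis artR : artinian_module (R^o : lmodType R).

Lemma rad_pow_eq0 : exists n, forall (V : lmodType R) (x : V), rad_pow n x -> x = 0.
Proof.
have [n nP] := rad_nilpotent artR; exists n => V x xn.
pose G k (x : V) := exists s y,
  [/\ size s = k, (forall a, a \in s -> rad a) & x = seq_prod s *: y].
(* The nested spans of [rad_pow] flatten to multiples by products of [n] radical elements; a scalar
   between two factors is absorbed by [radMr]. *)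
have {}xn : span (G n) x.
  move: {nP}n x xn => n; elim: n => [|n IH] x.
    by move=> _; apply: span_mem; exists [::], x; rewrite /seq_prod big_nil scale1r.
  apply: span_sub (span_submod _) _ _ => _ [j [y [jJ /IH yn ->]]].
  elim: yn j jJ => [_ [s [z [<- sJ ->]]]||y1 y2 _ IH1 _ IH2|a y1 _ IH1] j jJ.
  - apply: span_mem; exists (j :: s), z; split=> // [b|].
      by rewrite inE => /predU1P[->|/sJ].
    by rewrite scalerA /seq_prod big_cons.
  - by rewrite scaler0; apply: span0.
  - by rewrite scalerDr; apply: spanD; [apply: IH1|apply: IH2].
  - by rewrite scalerA; apply/IH1/radMr.
apply: (span_sub (N := fun x => x = 0) _ _ xn).
  by split=> // [y z -> ->|a y ->]; rewrite ?addr0 ?scaler0.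
by move=> _ [s [y [/nP sn /sn-> ->]]]; rewrite scale0r.
Qed.

(** Take [N'] minimal between [W] and [N] such that [N / N'] is finitely generated. If [N'] were not
    [W], a cyclic submodule of [N'] not contained in [W] would split off modulo [W], and its
    complement would be smaller at the cost of one more generator. *)
Lemma fg_mod_rad (M : lmodType R) (N W : M -> Prop) : artinian_module M ->
  is_submod N -> is_submod W -> (forall x, W x -> N x) ->
  (forall j x, rad j -> N x -> W (j *: x)) ->
  exists2 t : seq M, (forall x, x \in t -> N x) &
    forall x, N x -> exists2 y, span (fun z => z \in t) y & W (x - y).
Proof.
move=> artM sN sW WN JNW.
have [|N' [sN' [WN' N'N [t tN tN']] N'min]] := artinian_minimal artM (Q := fun N' =>
    [/\ forall x, W x -> N' x, forall x, N' x -> N x &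
     exists2 t : seq M, (forall x, x \in t -> N x) &
       forall x, N x -> exists2 y, span (fun z => z \in t) y & N' (x - y)]).
  exists N => //; split=> //; exists [::] => // x Nx.
  by exists 0; [apply: span0|rewrite subr0].
have [N'W|] := pselect (forall x, N' x -> W x).
  by exists t => // x /tN'[y ty /N'W]; exists y.
move=> /existsNP[v /not_implyP[N'v nWv]]; exfalso.
have [|e _ nWe] := exists_rad_min artR sW _ nWv.
  by move=> j jJ; apply: JNW => //; apply: N'N.
have N'ev : N' (e *: v) by apply: submodZ.
have [||U [sU WU UN' UW UD]] := @complement_mod_rad R artR M N' W _ sN' sW
    (is_submod_cycle (e *: v)) WN'.
- by move=> _ [a ->]; apply: (submodZ sN').
- by move=> j x jJ /N'N; apply: JNW.
apply/nWe/UW; last by exists 1; rewrite scale1r.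
apply: (N'min U sU) => //; split=> // [x /UN'/N'N //|].
exists (e *: v :: t) => [x|x Nx].
  by rewrite inE => /predU1P[->|/tN //]; apply: N'N.
have [y ty N'xy] := tN' x Nx; have [_ [a ->] Uxy] := UD _ N'xy.
exists (y + a *: (e *: v)); last by rewrite opprD addrA.
apply: spanD; first by apply: span_incl ty => z zt; rewrite inE zt orbT.
by apply/spanZ/span_mem; rewrite inE eqxx.
Qed.

(** Downward induction along the intersections of [N] with the [rad_pow n], starting from a
    vanishing one; the layers are killed by the radical, so [fg_mod_rad] applies to them. *)
Lemma artinian_fg_submod (M : lmodType R) (N : M -> Prop) : artinian_module M ->
  is_submod N -> fg_submod N.
Proof.
move=> artM sN; have [m mP] := rad_pow_eq0.
suff fgN k n : (n + k)%N = m -> forall N : M -> Prop, is_submod N ->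
    (forall x, N x -> rad_pow n x) -> fg_submod N.
  by apply: (fgN m 0%N).
elim: k n => [|k IH] n nk {sN}N sN Nn.
  exists [::] => // x /Nn; rewrite addn0 in nk; rewrite nk => /mP->.
  exact: span0.
have sW := is_submodI sN (rad_pow_submod n.+1 M).
have [||t tN tW] := fg_mod_rad artM sN sW.
- by move=> x [].
- by move=> j x jJ Nx; split; [apply: submodZ|apply: rad_pow_scale => //; apply: Nn].
apply: (fg_submod_mod sN tN tW); apply: (IH n.+1); first by rewrite addSnnS.
  exact: (is_submodI sN sW).
by move=> x [_ []].
Qed.

(** The Hopkins-Levitzki theorem. In [R^n], induction on the number [k] of leading coordinates that
    may be nonzero: the last of these takes its values in a finitely generated left ideal, and its
    kernel has one coordinate fewer. *)
Theorem artinian_noetherian : noetherian.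
Proof.
move=> n N; apply: fg_submodule.
suff fgN k (N' : 'rV[R]_n -> Prop) : is_submod N' ->
    (forall u (i : 'I_n), N' u -> (k <= i)%N -> u 0 i = 0) -> fg_submod N'.
  apply: (fgN n); first exact: submodClosedP.
  by move=> u i _; rewrite leqNgt ltn_ord.
elim: k N' => [|k IH] N' sN' N'k.
  exists [::] => // u N'u; suff -> : u = 0 by apply: span0.
  by apply/rowP => i; rewrite mxE N'k.
have [kn|nk] := ltnP k n; last first.
  by apply: IH => // u i _ /(leq_trans nk); rewrite leqNgt ltn_ord.
pose i0 := Ordinal kn.
have lf : linear (fun u : 'rV[R]_n => u 0 i0 : R^o) by move=> a u v; rewrite !mxE.
pose f : {linear _ -> _} := linear_of lf.
have sI := is_submod_image f sN'.
have [t tI It] := artinian_fg_submod artR sI.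
have [t' t'N t'E] : exists2 t' : seq 'rV_n, (forall x, x \in t' -> N' x) & map f t' = t.
  elim: t tI {It} => [|a t IHt] tI; first by exists [::].
  have [|t' t'N t'E] := IHt; first by move=> x xt; apply: tI; rewrite inE xt orbT.
  have [|u N'u ua] := tI a; first by rewrite inE eqxx.
  by exists (u :: t') => [x|]; [rewrite inE => /predU1P[->|/t'N]|rewrite map_cons ua t'E].
apply: (@fg_submod_mod _ N' (fun x => f x = 0) t') => // [x N'x|].
  have [y ty fy] : exists2 y, span (fun z => z \in t') y & f y = f x.
    apply: (span_sub (is_submod_image f (span_submod _))) (It (f x) _); last by exists x.
    rewrite -t'E => _ /mapP[z zt ->]; exists z => //; exact: span_mem.
  by exists y => //; rewrite linearB fy subrr.
apply: IH => [|u i [N'u fu]].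
  apply: is_submodI => //; split; first exact: linear0.
  - by move=> x y fx fy; rewrite linearD fx fy addr0.
  - by move=> a x fx; rewrite linearZ_LR fx scaler0.
rewrite leq_eqVlt => /predU1P[ki|]; last exact: N'k.
by rewrite -[RHS]fu /=; congr (u _ _); apply: val_inj.
Qed.

Section Quotient.
Context (V : lmodType R) (N : submodClosed V).
Lemma quotient_proj_linear : linear (quotient_proj N).
Proof. by move=> a x y; rewrite quotient_projD quotient_projZ. Qed.
Definition quotient_map : {linear V -> quotient_module N} :=
  linear_of quotient_proj_linear.
Lemma quotient_map_surj y : exists x, quotient_map x = y.
Proof. by exists (repr (y : Quotient.quot (submod_pred N))); apply: quotient_reprK. Qed.
Lemma quotient_map_eq0 x : quotient_map x = 0 <-> x \in N.
Proof. by rewrite -[x in x \in N]subr0 -quotient_projP quotient_proj0. Qed.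
End Quotient.

(* A retraction exists modulo the radical by complete reducibility; it lifts to
   some r, and 1 - r i has nilpotent image, so that r i is invertible. *)
Lemma split_mod_rad (P Q : lmodType R) (i : {linear P -> Q}) : projective Q ->
  (forall x, rad_pow 1 (i x) -> rad_pow 1 x) ->
  exists r : {linear Q -> P}, forall x, r (i x) = x.
Proof.
move=> pQ iJ.
have sI := is_submod_image i (is_submodT P).
have [|U [sU JU _ UJ UI]] := @complement_mod_rad R artR Q (fun _ => True) _ _
  (is_submodT Q) (rad_pow_submod 1 Q) sI (fun _ _ => Logic.I) (fun _ _ => Logic.I).
  by move=> j x jJ _; apply: rad_pow_scale.
have UiJ x : U (i x) -> rad_pow 1 x by move=> Uix; apply/iJ/UJ => //; exists x.
(* The choice [b] of preimages modulo [U] is linear only modulo the radical of [P]; it becomes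
   linear after [pi], and projectivity of [Q] lifts it to [r]. *)
have /choice[b bP] c : exists x, U (c - i x).
  by have [_ [x _ <-] Ucx] := UI c Logic.I; exists x.
have sJ := rad_pow_submod 1 P.
pose pi := quotient_map (submod_of sJ).
have piP x y : rad_pow 1 (x - y) -> pi x = pi y.
  by move=> xy; apply/subr0_eq; rewrite -linearB; apply/quotient_map_eq0/in_submod_of.
have lb : linear (fun c => pi (b c)).
  move=> a x y; rewrite -linearP; apply/piP/UiJ.
  have -> : i (b (a *: x + y) - (a *: b x + b y)) =
      a *: (x - i (b x)) + (y - i (b y)) - (a *: x + y - i (b (a *: x + y))).
    by rewrite linearB linearP scalerBr opprB [X in _ = X + _]addrACA -opprD [RHS]addrC addrA subrK.
  by apply: (submodB sU) => //; apply: (submodD sU) => //; apply: (submodZ sU).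
have [r rP] := pQ _ _ pi (linear_of lb) (@quotient_map_surj _ _).
have ri x : rad_pow 1 (x - r (i x)).
  rewrite -[X in X - _](subrK (b (i x)) x) -addrA; apply: (submodD sJ).
    by apply: UiJ; rewrite linearB.
  by apply/(in_submod_of sJ)/quotient_projP/esym; apply: (rP (i x)).
(* With r_(n+1) = r + r_n - r i r_n one has 1 - r_(n+1) i = (1 - r i)(1 - r_n i), so each step gains
   a power of the radical. *)
have rn n : exists rn : {linear Q -> P}, forall x, rad_pow n (x - rn (i x)).
  elim: n => [|n [rn rnP]]; first by exists \0.
  exists (r \+ (rn \- (r \o i \o rn))) => x; rewrite -addn1.
  pose th : {linear P -> P} := idfun \- (r \o i).
  suff -> : x - (r \+ (rn \- (r \o i \o rn))) (i x) = th (x - rn (i x)).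
    by apply: rad_pow_map.
  by rewrite /th /= !linearB /= addrCA opprD addrA opprK opprB [X in _ = _ + X]addrC.
have [m mP] := rad_pow_eq0; have [r' r'P] := rn m; exists r' => x.
by apply/esym/subr0_eq/mP.
Qed.

End Linear.

(** * Syzygies, projective dimension and vanishing of Ext *)

Section Syzygies.
Context {R : pzRingType}.
Implicit Types M N K P : lmodType R.

Definition ses K P M (i : {linear K -> P}) (p : {linear P -> M}) :=
  [/\ forall k, i k = 0 -> k = 0, forall y, exists x, p x = y &
      forall x, p x = 0 <-> exists k, i k = x].

Lemma ses_comp0 K P M (i : {linear K -> P}) (p : {linear P -> M}) k :
  ses i p -> p (i k) = 0.
Proof. by case=> _ _ ip; apply/ip; exists k. Qed.

Lemma ses_ker P M (p : {linear P -> M}) : (forall y, exists x, p x = y) ->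
  ses (val : submodule (ker p) -> P) p.
Proof.
move=> pS; split=> // [k k0|x]; first by apply: val_inj; rewrite k0 raddf0.
split=> [px|[k <-]]; last by apply/eqP; rewrite -in_ker; apply: valP.
have xK : x \in ker p by rewrite in_ker px.
by exists (Submodule xK).
Qed.

(* M is a direct summand of M' up to a map that factors through a projective:
   syzygies are determined by the module up to this relation. *)
Definition stable_retract M M' :=
  exists (Q : lmodType R) (a : {linear M -> M'}) (b : {linear M' -> M})
    (s : {linear M -> Q}) (t : {linear Q -> M}),
    projective Q /\ forall x, x = b (a x) + t (s x).

Lemma retract_stable M M' (a : {linear M -> M'}) (b : {linear M' -> M}) :
  (forall x, b (a x) = x) -> stable_retract M M'.
Proof.
move=> ba; exists ('rV[R]_0 : lmodType R), a, b, \0, \0; split=> [|x].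
  exact: row_projective.
by rewrite ba addr0.
Qed.

Lemma stable_retract_refl M : stable_retract M M.
Proof. exact: (@retract_stable M M idfun idfun). Qed.

Lemma stable_retract_projective M M' :
  stable_retract M M' -> projective M' -> projective M.
Proof.
move=> [Q [a [b [s [t [pQ baE]]]]]] pM' U V g f gS.
have [h hP] := pM' _ _ g (f \o b) gS; have [k kP] := pQ _ _ g (f \o t) gS.
exists ((h \o a) \+ (k \o s)) => x /=.
by rewrite linearD hP kP /= -linearD -baE.
Qed.

(** A form of Schanuel's lemma. Lift [a], [b], [t] to [a'], [b'], [t'] on projectives; then 1 - b'
    a' - t' s p is killed by [p], so it factors through [K], and on [K] it reduces to 1 - b' a'. *)
Lemma stable_retract_ses M M' K P K' P' (i : {linear K -> P}) (p : {linear P -> M})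
    (i' : {linear K' -> P'}) (p' : {linear P' -> M'}) :
  stable_retract M M' -> projective P -> projective P' -> ses i p -> ses i' p' ->
  exists (a : {linear K -> K'}) (a' : {linear P -> P'}) (b : {linear K' -> K})
    (s : {linear P -> K}),
    (forall k, i' (a k) = a' (i k)) /\ forall k, k = b (a k) + s (i k).
Proof.
move=> [Q [a [b [s [t [pQ baE]]]]]] pP pP' sip sip'.
have [i0 pS ip] := sip; have [i'0 p'S ip'] := sip'.
have [a' a'P] := pP _ _ p' (a \o p) p'S.
have [b' b'P] := pP' _ _ p (b \o p') pS.
have [t' t'P] := pQ _ _ p t pS.
have [k|ka kaP] := @factor_inj _ _ _ _ i' (a' \o i) i'0.
  by apply/ip'; rewrite a'P /= (ses_comp0 _ sip) linear0.
have [k|kb kbP] := @factor_inj _ _ _ _ i (b' \o i') i0.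
  by apply/ip; rewrite b'P /= (ses_comp0 _ sip') linear0.
pose f : {linear P -> P} := idfun \- ((b' \o a') \+ (t' \o s \o p)).
have [x|h hP] := @factor_inj _ _ _ _ i f i0.
  by apply/ip; rewrite /f /= linearB linearD /= b'P /= a'P t'P /= -baE subrr.
exists ka, a', kb, h; split=> // k; apply/subr0_eq/i0.
rewrite linearB linearD kbP /= kaP hP /f /= (ses_comp0 _ sip) !linear0 addr0.
by apply/eqP; rewrite subr_eq0 [eqbRHS]addrC subrK.
Qed.

Lemma stable_retract_syz M M' K P K' P' (i : {linear K -> P}) (p : {linear P -> M})
    (i' : {linear K' -> P'}) (p' : {linear P' -> M'}) :
  stable_retract M M' -> projective P -> projective P' -> ses i p -> ses i' p' ->
  stable_retract K K'.
Proof.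
move=> MM' pP pP' sip sip'.
have [a [a' [b [s [_ baE]]]]] := stable_retract_ses MM' pP pP' sip sip'.
by exists P, a, b, i, s.
Qed.

(** Vanishing of Ext^1(-, N) passes to stable retracts: in f = f b a + f s i the second term is
    already defined on [P], and [f b] extends by hypothesis. *)
Lemma stable_retract_extend M M' N K P K' P' (i : {linear K -> P}) (p : {linear P -> M})
    (i' : {linear K' -> P'}) (p' : {linear P' -> M'}) :
  stable_retract M M' -> projective P -> projective P' -> ses i p -> ses i' p' ->
  (forall f : {linear K' -> N}, exists w : {linear P' -> N}, forall k, w (i' k) = f k) ->
  forall f : {linear K -> N}, exists w : {linear P -> N}, forall k, w (i k) = f k.
Proof.
move=> MM' pP pP' sip sip' E f.
have [a [a' [b [s [aa' baE]]]]] := stable_retract_ses MM' pP pP' sip sip'.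
have [w wP] := E (f \o b); exists ((w \o a') \+ (f \o s)) => k /=.
by rewrite -aa' wP /= -linearD -baE.
Qed.

(** A relation, so that every choice of projectives is allowed at each stage. *)
Fixpoint syz n M K : Prop :=
  if n is n'.+1 then
    exists K1 P (i : {linear K1 -> P}) (p : {linear P -> M}),
      [/\ projective P, ses i p & syz n' K1 K]
  else K = M.

Lemma syz_stable n M M' K K' :
  stable_retract M M' -> syz n M K -> syz n M' K' -> stable_retract K K'.
Proof.
elim: n M M' => [|n IH] M M' MM' /=; first by move=> -> ->.
move=> [K1 [P [i [p [pP sip nK]]]]] [K1' [P' [i' [p' [pP' sip' nK']]]]].
exact: IH (stable_retract_syz MM' pP pP' sip sip') nK nK'.
Qed.

(** [syz] unfolds next to [M]; this splits off the last step instead. *)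
Lemma syz_belast n M K' : syz n.+1 M K' ->
  exists K P (i : {linear K' -> P}) (p : {linear P -> K}),
    [/\ syz n M K, projective P & ses i p].
Proof.
elim: n M => [|n IH] M [K1 [P [i [p [pP sip nK]]]]].
  by rewrite /= in nK; subst K1; exists M, P, i, p.
have [K [P' [i' [p' [nK1 pP' sip']]]]] := IH _ nK.
by exists K, P', i', p'; split=> //; exists K1, P, i, p.
Qed.

(** One projective [n]-th syzygy suffices: by [pdle_syz] all the others are then projective. *)
Definition pdle n M := exists2 K, syz n M K & projective K.

Lemma pdle_syz n M K : pdle n M -> syz n M K -> projective K.
Proof.
move=> [K' nK' pK'] nK; apply: stable_retract_projective pK'.
exact: syz_stable (stable_retract_refl M) nK nK'.
Qed.

Lemma pdle_ses n M K P (i : {linear K -> P}) (p : {linear P -> M}) :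
  projective P -> ses i p -> pdle n.+1 M -> pdle n K.
Proof.
move=> pP sip [K' [K1 [P' [i' [p' [pP' sip' nK']]]]] pK'].
(* Some [n]-th syzygy of [K], built from free covers, to be compared with [K']. *)
have [L nL] : exists L, syz n K L.
  elim: n K {pP sip i nK'} => [|n IH] K; first by exists K.
  have [L nL] := IH (submodule (ker (free_cover K))); exists L.
  exists (submodule (ker (free_cover K))), (free_module K), val, (free_cover K).
  split=> //; first exact: free_projective.
  exact: ses_ker (@free_cover_surj R K).
exists L => //; apply: stable_retract_projective pK'.
apply: syz_stable nL nK'.
exact: stable_retract_syz (stable_retract_refl M) pP pP' sip sip'.
Qed.

(** * Prolonging and truncating projective resolutions *)

Section ConsResolution.
Context (M K P : lmodType R) (i : {linear K -> P}) (p : {linear P -> M}).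
Hypotheses (pP : projective P) (sip : ses i p).
Variable (r : proj_resolution K).

Definition cons_res_mod n : lmodType R := if n is n'.+1 then r n' else P.
Definition cons_res_d n : {linear cons_res_mod n.+1 -> cons_res_mod n} :=
  match n with 0%N => i \o res_aug r | n'.+1 => res_d r n' end.

Fact cons_res_projective n : projective (cons_res_mod n).
Proof. by case: n => //= n; apply: res_projective. Qed.

Fact cons_res_exact n : ker (cons_res_d n) =i im (cons_res_d n.+1).
Proof.
case: n => [|n]; last exact: res_exact.
move=> x; rewrite -[RHS](@res_exact_aug _ _ r x) !in_ker /=.
have [i0 _ _] := sip; apply/eqP/eqP => [/i0 //|->]; exact: linear0.
Qed.

Fact cons_res_exact_aug : ker p =i im (cons_res_d 0%N).
Proof.
move=> x; rewrite in_ker in_im; have [_ _ ip] := sip.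
apply/eqP/asboolP => [/ip[k <-]|[y <-]]; last exact: ses_comp0 sip.
by have [y <-] := res_aug_surj r k; exists y.
Qed.

Definition cons_resolution : proj_resolution M :=
  @ProjResolution R M cons_res_mod cons_res_d p cons_res_projective cons_res_exact
    cons_res_exact_aug (let: And3 _ pS _ := sip in pS).
End ConsResolution.

Section BeheadResolution.
Context (M : lmodType R) (r : proj_resolution M).
Let K := submodule (ker (res_aug r)).

Fact behead_aug_ker x : res_d r 0%N x \in ker (res_aug r).
Proof. by rewrite res_exact_aug in_im; apply/asboolP; exists x. Qed.
Definition behead_aug_fun x : K := Submodule (behead_aug_ker x).
Fact behead_aug_linear : linear behead_aug_fun.
Proof. by move=> a x y; apply: val_inj; rewrite /= !linearP. Qed.
Definition behead_aug : {linear r 1%N -> K} := linear_of behead_aug_linear.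

Fact behead_exact_aug : ker behead_aug =i im (res_d r 1%N).
Proof.
move=> x; rewrite -res_exact !in_ker.
exact: esym (inj_eq val_inj (behead_aug x) 0).
Qed.

Fact behead_aug_surj y : exists x, behead_aug x = y.
Proof.
have := valP y; rewrite res_exact_aug in_im => /asboolP[x xE].
by exists x; apply: val_inj.
Qed.

Definition behead_resolution : proj_resolution K :=
  @ProjResolution R K (fun n => r n.+1) (fun n => res_d r n.+1) behead_aug
    (fun n => @res_projective _ _ r n.+1) (fun n => @res_exact _ _ r n.+1) behead_exact_aug
    behead_aug_surj.
End BeheadResolution.

Lemma pdleP n M :
  pdle n M <-> exists r : proj_resolution M, forall i, (n < i)%N -> is_zero_module (r i).
Proof.
split.
  elim: n M => [|n IH] M [K].
    move=> /= -> pM.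
    have z0 : projective ('rV[R]_0 : lmodType R) by apply: row_projective.
    have zE (x : 'rV[R]_0) : x = 0 by apply/rowP => -[].
    pose mods n : lmodType R := if n is _.+1 then 'rV[R]_0 else M.
    have mP k : projective (mods k) by case: k.
    pose d k : {linear mods k.+1 -> mods k} := \0.
    have exd k : ker (d k) =i im (d k.+1).
      move=> x; rewrite in_ker in_im eqxx; apply/esym/asboolP.
      by exists 0; apply/esym/zE.
    have exa : ker (idfun : {linear M -> M}) =i im (d 0%N).
      move=> x; rewrite in_ker in_im; apply/eqP/asboolP => [/= ->|[y <-]] //.
      by exists 0.
    have aS (y : M) : exists x : M, idfun x = y by exists y.
    exists (@ProjResolution R M mods d (idfun : {linear M -> M}) mP exd exa aS).
    by case.
  move=> [K1 [P [i [p [pP sip nK]]]]] pK.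
  have [|r rn] := IH K1; first by exists K.
  by exists (cons_resolution pP sip r); case=> // k; apply: rn.
elim: n M => [|n IH] M [r rn].
  exists M => //; have r1 := rn 1%N isT.
  have inj x : res_aug r x = 0 -> x = 0.
    move=> /eqP; rewrite -in_ker res_exact_aug in_im => /asboolP[y <-].
    by rewrite (r1 y) linear0.
  have [x|s sP] := @factor_inj _ _ _ _ (res_aug r) idfun inj.
    exact: res_aug_surj.
  exact: (projective_retract (@res_projective _ _ r 0%N) sP).
have [|K nK pK] := IH (submodule (ker (res_aug r))).
  by exists (behead_resolution r) => k nk; apply: rn.
exists K => //; exists (submodule (ker (res_aug r))), (r 0%N), val, (res_aug r).
by split=> //; [apply: res_projective|apply/ses_ker/res_aug_surj].
Qed.

Lemma inf_natP (P : set nat) n :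
  inf_nat P = Some n <-> P n /\ forall m, P m -> (n <= m)%N.
Proof.
rewrite /inf_nat; case: pselect => [ex|nex].
  case: ex_minnP => m /asboolP Pm mmin; split=> [[<-]|[Pn nmin]].
    by split=> // k Pk; apply/mmin/asboolP.
  by congr Some; apply/eqP; rewrite eqn_leq nmin // mmin //; apply/asboolP.
by split=> // -[Pn _]; case: nex; exists n; apply/asboolP.
Qed.

Lemma projdimP M n :
  projdim M = Some n <-> pdle n M /\ forall m, pdle m M -> (n <= m)%N.
Proof.
rewrite inf_natP /=; split=> -[Mn nmin]; split; first exact/pdleP.
- by move=> m /pdleP; apply: nmin.
- exact/pdleP.
- by move=> m /pdleP; apply: nmin.
Qed.

Lemma pdle_leq n m M : (n <= m)%N -> pdle n M -> pdle m M.
Proof.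
move=> nm /pdleP[r rn]; apply/pdleP; exists r => i mi.
exact/rn/(leq_ltn_trans nm).
Qed.

(* The syzygies L t of a projective resolution, with the shift
   ... -> L t -> G t, G t.+1 -> L t such that Ext^t(L 0, N) is the cokernel of
   Hom(G t, N) -> Hom(L t, N) for every t, the term G 0 being zero. *)
Record chain := Chain {
  ch_L : nat -> lmodType R;
  ch_G : nat -> lmodType R;
  ch_i : forall t, {linear ch_L t -> ch_G t};
  ch_p : forall t, {linear ch_G t.+1 -> ch_L t};
  ch_projective : forall t, projective (ch_G t);
  ch_G0 : is_zero_module (ch_G 0%N);
  ch_ses : forall t, ses (ch_i t.+1) (ch_p t) }.

(** This is Ext^t([ch_L c 0], N) = 0; for [t = 0] it says Hom = 0, since [ch_G c 0] is zero. *)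
Definition ext_vanish (c : chain) t N :=
  forall f : {linear ch_L c t -> N},
    exists w : {linear ch_G c t -> N}, forall l, w (ch_i c t l) = f l.

(** * Independence of the resolution *)

Section ChainCompare.
Context (c c' : chain).
Variables (a : {linear ch_L c 0%N -> ch_L c' 0%N}) (b : {linear ch_L c' 0%N -> ch_L c 0%N}).
Hypothesis ba : forall x, b (a x) = x.

Lemma chain_stable t : stable_retract (ch_L c t) (ch_L c' t).
Proof.
elim: t => [|t IH]; first exact: retract_stable ba.
exact: stable_retract_syz IH (@ch_projective c t.+1) (@ch_projective c' t.+1)
  (ch_ses c t) (ch_ses c' t).
Qed.

Lemma chain_compare t : exists (a : {linear ch_L c t -> ch_L c' t})
    (b : {linear ch_L c' t -> ch_L c t}) (s : {linear ch_G c t -> ch_L c t}),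
  forall x, x = b (a x) + s (ch_i c t x).
Proof.
case: t => [|t]; first by exists a, b, \0 => x /=; rewrite ba addr0.
have [a' [_ [b' [s [_ E]]]]] := stable_retract_ses (chain_stable t)
  (@ch_projective c t.+1) (@ch_projective c' t.+1) (ch_ses c t) (ch_ses c' t).
by exists a', b', s.
Qed.

Lemma ext_vanish_transfer t N : ext_vanish c' t N -> ext_vanish c t N.
Proof.
case: t => [|t] E f.
  have [w wP] := E (f \o b); exists \0 => x.
  by rewrite -[x in RHS]ba -[RHS]wP (ch_G0 (ch_i c' 0%N (a x))) linear0.
exact: (stable_retract_extend (chain_stable t) (@ch_projective c t.+1)
  (@ch_projective c' t.+1) (ch_ses c t) (ch_ses c' t) E).
Qed.
End ChainCompare.

Section FreeChain.
Variable M : lmodType R.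
(** The index is shifted by one: the term [t.+1] is the module in degree [t] of
    [free_resolution M]. *)
Definition free_chain_G t : lmodType R :=
  if t is t'.+1 then free_module (syzygy M t') else 'rV[R]_0.
Definition free_chain_i t : {linear syzygy M t -> free_chain_G t} :=
  match t with 0%N => \0 | t'.+1 => val end.
Fact free_chain_projective t : projective (free_chain_G t).
Proof. by case: t => [|t]; [apply: row_projective|apply: free_projective]. Qed.
Fact free_chain_G0 : is_zero_module (free_chain_G 0%N).
Proof. by move=> x; apply/rowP => -[]. Qed.
Fact free_chain_ses t : ses (free_chain_i t.+1) (free_cover (syzygy M t)).
Proof. exact: ses_ker (@free_cover_surj R _). Qed.
Definition free_chain := @Chain (syzygy M) free_chain_G free_chain_i
  (fun t => free_cover (syzygy M t)) free_chain_projective free_chain_G0 free_chain_ses.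
End FreeChain.

Lemma subquotient_eq0 (V : lmodType R) (Z B : submodClosed V) :
  is_zero_module (subquotient Z B) -> forall z, z \in Z -> z \in B.
Proof.
move=> zQ z zZ; have := zQ (quotient_proj (restr Z B) (Submodule zZ)).
by move=> /quotient_map_eq0.
Qed.
End Syzygies.

Section ExtVanish.
Context {R : pzRingType}.

Definition dual_linear (P : lmodType R) (f : dual P) : {linear P -> R^o} :=
  linear_of (dual_lin f).

Definition dual_of (P : lmodType R) (f : {linear P -> R^o}) : dual P :=
  Dual (linearP f).

(** A map on the [t]-th syzygy composed with the free cover is a cocycle; it is a coboundary exactly
    when the map extends to [free_chain_G M t]. *)
Lemma Ext_vanish (M : lmodType R) t :
  is_zero_module (Ext M t) -> ext_vanish (free_chain M) t R^o.
Proof.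
move=> zE f.
have cov0 k x : free_cover (syzygy M k) (free_res_d M k x) = 0.
  by apply/eqP; rewrite -in_ker free_res_exact_aux in_im; apply/asboolP; exists x.
pose z : dual (free_res_mod M t) := dual_of (f \o free_cover (syzygy M t)).
have zZ : z \in cocycles (free_resolution M) t.
  rewrite in_ker; apply/eqP/dual_ext => x /=; by rewrite cov0 linear0.
have := subquotient_eq0 zE zZ.
case: t f @z zZ {zE} => [|t] f z zZ.
  move=> /eqP z0; exists \0 => x /=; have [y <-] := free_cover_surj x.
  by rewrite -[RHS]/(z y) z0.
rewrite in_im => /asboolP[g gz]; exists (dual_linear g) => x /=.
have [y <-] := free_cover_surj x.
by rewrite -[RHS]/(z y) -gz.
Qed.

End ExtVanish.

(** * Duality *)

Section FgChain.
Context {R : pzRingType}.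
Hypothesis nR : @noetherian R.

(** Finite generation is carried along so that covers of finite rank can be iterated. *)
Definition fg_module := {M : lmodType R | fg M}.
Definition fg_rank (M : fg_module) : nat := sval (cid (svalP M)).
Definition fg_cover (M : fg_module) : {linear 'rV[R]_(fg_rank M) -> sval M} :=
  sval (cid (svalP (cid (svalP M)))).
Lemma fg_cover_surj (M : fg_module) y : exists x, fg_cover M x = y.
Proof. exact: (svalP (cid (svalP (cid (svalP M))))). Qed.
Definition fg_next (M : fg_module) : fg_module :=
  exist _ (submodule (ker (fg_cover M)) : lmodType R) (nR _).

Variable M : fg_module.
Definition fg_syz t := iter t fg_next M.
Definition fg_chain_G t : lmodType R :=
  if t is t'.+1 then 'rV[R]_(fg_rank (fg_syz t')) else 'rV[R]_0.
Definition fg_chain_i t : {linear sval (fg_syz t) -> fg_chain_G t} :=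
  match t with 0%N => \0 | t'.+1 => val end.
Fact fg_chain_projective t : projective (fg_chain_G t).
Proof. by case: t => [|t]; apply: row_projective. Qed.
Fact fg_chain_G0 : is_zero_module (fg_chain_G 0%N).
Proof. by move=> x; apply/rowP => -[]. Qed.
Fact fg_chain_ses t : ses (fg_chain_i t.+1) (fg_cover (fg_syz t)).
Proof. exact: ses_ker (@fg_cover_surj _). Qed.
Definition fg_chain := @Chain R (fun t => sval (fg_syz t)) fg_chain_G fg_chain_i
  (fun t => fg_cover (fg_syz t)) fg_chain_projective fg_chain_G0 fg_chain_ses.

Lemma fg_chain_row t : exists n, ch_G fg_chain t = 'rV[R]_n.
Proof. by case: t => [|t]; [exists 0%N|exists (fg_rank (fg_syz t))]. Qed.
Lemma fg_chain_L t : fg (ch_L fg_chain t).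
Proof. exact: (svalP (fg_syz t)). Qed.
End FgChain.

(** * Vanishing of Ext on projectives and on high syzygies *)

Section ExtVanishTheory.
Context {R : pzRingType}.
Implicit Types M N K P : lmodType R.

(** [N] is a summand of a free module, and as [ch_L c t] is finitely generated, [f] involves only a
    finite set [T] of coordinates. Each of these extends by hypothesis. *)
Lemma ext_vanish_projective (c : chain) t N : fg (ch_L c t) ->
  ext_vanish c t (R^o : lmodType R) -> projective N -> ext_vanish c t N.
Proof.
move=> [n [g gS]] E pN f; have [s sK] := projective_section pN.
have /choice[S SP] (i : 'I_n) := free_supp (s (f (g (delta_mx 0 i)))).
pose T := undup (flatten [seq S i | i <- enum 'I_n]).
have TP l x : x \notin T -> free_coef (s (f l)) x = 0.
  move=> xT; have [u <-] := gS l.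
  have lc : linear (fun u => free_coef (s (f (g u))) x : R^o).
    by move=> a u1 u2; rewrite !linearP.
  rewrite -[LHS]/(linear_of lc u) row_combE /row_comb big1 // => i _ /=.
  rewrite (proj2 (SP i)) ?scaler0 //; apply: contra xT => xS.
  by rewrite mem_undup; apply/flatten_mapP; exists i; rewrite ?mem_enum.
have /choice[w wP] x : exists w : {linear ch_G c t -> R^o},
    forall l, w (ch_i c t l) = free_coef (s (f l)) x.
  have lc : linear (fun l => free_coef (s (f l)) x : R^o).
    by move=> a u1 u2; rewrite !linearP.
  by have [w wP] := E (linear_of lc); exists w.
have lw : linear (fun y => \sum_(x <- T) (w x y : R) *: x).
  move=> a y z; rewrite scaler_sumr -big_split; apply: eq_bigr => x _.
  by rewrite linearP scalerDl scalerA.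
exists (linear_of lw) => l /=; rewrite -[RHS]sK.
rewrite [RHS](free_liftE _ (undup_uniq _) (TP l)).
by apply: eq_bigr => x _; rewrite wP.
Qed.

(* Injectivity of Ext^t(E, K') -> Ext^t(E, P) when Ext^(t-1)(E, K) = 0. *)
Lemma ext_vanish_inj (c : chain) t K' P K (i : {linear K' -> P}) (p : {linear P -> K})
    (f : {linear ch_L c t -> K'}) (w : {linear ch_G c t -> P}) :
  ses i p -> (forall t', t = t'.+1 -> ext_vanish c t' K) ->
  (forall l, w (ch_i c t l) = i (f l)) ->
  exists w' : {linear ch_G c t -> K'}, forall l, w' (ch_i c t l) = f l.
Proof.
move=> sip; have [i0 pS ip] := sip.
case: t f w => [|t] f w E wP.
  exists \0 => l; apply/esym/i0; rewrite -wP (ch_G0 (ch_i c 0%N l)).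
  exact: linear0.
have sL := ch_ses c t; have [_ pL iL] := sL.
(* [p w] kills the image of the next syzygy, so it comes from some [h]. Extending [h] to [v] and
   lifting [v] to [v'] gives the correction after which [w] lands in the kernel of [p]. *)
have [x /iL[l <-]|h hP] := @factor_surj _ _ _ _ (ch_p c t) (p \o w) pL.
  by rewrite /= wP (ses_comp0 _ sip).
have [v vP] := E t erefl h.
have [v' v'P] := @ch_projective _ c t _ _ p v pS.
pose g : {linear ch_G c t.+1 -> P} := w \- (v' \o ch_i c t \o ch_p c t).
have [x|w' w'P] := @factor_inj _ _ _ _ i g i0.
  by apply/ip; rewrite /g /= linearB /= v'P vP hP /= subrr.
exists w' => l; apply/subr0_eq/i0; rewrite linearB w'P /g /= (ses_comp0 _ sL).
by rewrite !linear0 addr0 wP subrr.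
Qed.

(** Dimension shift: for 0 -> K' -> P -> K -> 0, Ext^t(-, K') embeds in Ext^t(-, P) = 0 once
    Ext^(t-1)(-, K) = 0. *)
Lemma ext_vanish_syz (c : chain) j n (M K : lmodType R) :
  (forall t P, (t < j)%N -> projective P -> ext_vanish c t P) ->
  syz n M K -> forall t, (t < j)%N -> (t < n)%N -> ext_vanish c t K.
Proof.
move=> E; elim: n K => // n IH K' nK' t tj tn f.
have [K [P [i [p [nK pP sip]]]]] := syz_belast nK'.
have [w wP] := E t P tj pP (i \o f).
apply: (ext_vanish_inj sip _ wP) => t' tE; rewrite tE in tj tn.
by apply: IH nK _ _ _ => //; apply: ltnW.
Qed.

Lemma ses_split K P M (i : {linear K -> P}) (p : {linear P -> M}) :
  ses i p -> projective M -> exists r : {linear P -> K}, forall k, r (i k) = k.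
Proof.
move=> sip pM; have [i0 pS ip] := sip.
have [s sP] := pM _ _ p idfun pS.
have [x|r rP] := @factor_inj _ _ _ _ i (idfun \- (s \o p)) i0.
  by apply/ip; rewrite /= linearB /= sP subrr.
exists r => k; apply/subr0_eq/i0.
by rewrite linearB rP /= (ses_comp0 _ sip) linear0 subr0 subrr.
Qed.
End ExtVanishTheory.

(** * Duals of free modules and transposes *)

Section Duals.
Context {A : pzRingType}.

Fact row_coord_linear n (i : 'I_n) : linear ((fun u : 'rV[A]_n => u 0 i) : _ -> A^o).
Proof. by move=> a u v; rewrite !mxE. Qed.
Definition row_coord n (i : 'I_n) : dual 'rV[A]_n := Dual (@row_coord_linear n i).

Lemma dual_row_sum n (f : dual 'rV[A]_n) :
  f = \sum_i (f (delta_mx 0 i) : A^c) *: row_coord i.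
Proof.
apply: dual_ext => u.
rewrite (big_morph (fun f : dual 'rV[A]_n => f u) (id1 := 0) (op1 := +%R)) //.
rewrite -[LHS]/(dual_linear f u) row_combE; apply: eq_bigr => i _ //.
Qed.

Lemma dual_row_retract n :
  exists (r : {linear 'rV[A^c]_n -> dual 'rV[A]_n}) (s : {linear dual 'rV[A]_n -> 'rV[A^c]_n}),
    forall f, r (s f) = f.
Proof.
exists (linear_of (row_comb_linear (@row_coord n))).
have ls : linear (fun f : dual 'rV[A]_n => \row_i (f (delta_mx 0 i) : A^c)).
  by move=> a f g; apply/rowP => i; rewrite !mxE.
exists (linear_of ls) => f; rewrite [RHS]dual_row_sum.
by apply: eq_bigr => i _; rewrite mxE.
Qed.

Lemma dual_row_projective n : projective (dual 'rV[A]_n).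
Proof.
have [r [s rs]] := dual_row_retract n.
exact: projective_retract (@row_projective _ n) rs.
Qed.

Lemma dual_row_fg n : fg (dual 'rV[A]_n).
Proof.
have [r [s rs]] := dual_row_retract n.
by apply: fg_surj (fg_row n) => y; exists (s y); apply: rs.
Qed.

Lemma dual_row_reflexive n (ev : {linear dual 'rV[A]_n -> (A^c)^o}) :
  exists x : 'rV[A]_n, forall f : dual 'rV[A]_n, ev f = f x.
Proof.
exists (\row_i (ev (row_coord i) : A)) => f.
rewrite {1}[f]dual_row_sum linear_sum.
rewrite -[RHS]/(dual_linear f _) row_combE; apply: eq_bigr => i _.
by rewrite linearZ_LR mxE.
Qed.

Lemma row_reflexive (G : lmodType A) : (exists n, G = 'rV[A]_n) ->
  forall ev : {linear dual G -> (A^c)^o}, exists x : G, forall f : dual G, ev f = f x.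
Proof. by move=> [n ->]; apply: dual_row_reflexive. Qed.

Lemma row_separated (G : lmodType A) : (exists n, G = 'rV[A]_n) ->
  forall x : G, (forall f : dual G, f x = 0) -> x = 0.
Proof.
move=> [n ->] x x0; apply/rowP => i; rewrite [RHS]mxE.
exact: (x0 (row_coord i)).
Qed.

Lemma dual_fg (M : lmodType A) : @noetherian A^c -> fg M -> fg (dual M).
Proof.
move=> nB [n [g gS]]; apply: noetherian_inj (dual_map g) nB _ (dual_row_fg n).
move=> f f0; apply: dual_ext => y; have [x <-] := gS y.
by rewrite -[LHS]/(dual_map g f x) f0.
Qed.

(** The dual of a free module is a product of copies of the ring, even for infinite [X], so maps
    into it extend coordinatewise. *)
Lemma extend_dual_free (X : choiceType) (L G : lmodType A^c) (i : {linear L -> G})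
    (f : {linear L -> dual (free_module X)}) :
  (forall x, exists w : {linear G -> (A^c)^o}, forall l, w (i l) = f l (free_delta x)) ->
  exists w : {linear G -> dual (free_module X)}, forall l, w (i l) = f l.
Proof.
move=> /choice[w wP].
pose W g : dual (free_module X) := Dual (free_lift_linear (fun x => w x g : A^o)).
have WE g u s : uniq s -> (forall x, x \notin s -> free_coef u x = 0) ->
    W g u = \sum_(x <- s) free_coef u x * (w x g : A).
  by move=> us su; apply: (@free_liftE A X A^o (fun x => w x g) u s us su).
have lW : linear W.
  move=> a g h; apply: dual_ext => u; have [s [us su]] := free_supp u.
  rewrite (WE _ _ _ us su) dual_funD dual_funZ !(WE _ _ _ us su).
  rewrite mulr_suml -big_split; apply: eq_bigr => x _.
  by rewrite linearP mulrDr -mulrA.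
exists (linear_of lW) => l; apply: dual_ext => u; have [s [us su]] := free_supp u.
rewrite [LHS](WE _ _ _ us su) [u in RHS](free_decomp us su).
rewrite -[RHS]/(dual_linear (f l) _) linear_sum; apply: eq_bigr => x _.
by rewrite wP linearZ_LR.
Qed.

Section Transpose.
Variable c : chain (R := A).
Hypothesis rowG : forall t, exists n, ch_G c t = 'rV[A]_n.

Let D t : lmodType A^c := dual (ch_G c t).
Let d t : {linear ch_G c t.+1 -> ch_G c t} := ch_i c t \o ch_p c t.

Lemma ch_G_dual_projective t : projective (D t).
Proof. by rewrite /D; have [n ->] := rowG t; apply: dual_row_projective. Qed.

Lemma ch_G_dual_fg t : fg (D t).
Proof. by rewrite /D; have [n ->] := rowG t; apply: dual_row_fg. Qed.

Lemma ch_d2 t x : d t (d t.+1 x) = 0.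
Proof. by rewrite /d /= (ses_comp0 _ (ch_ses c t)) linear0. Qed.

(** For [t > 0] the Auslander transpose of [ch_L c t.-1]; for [t = 0] it is the dual of [ch_G c 1],
    since [ch_G c 0] is zero. *)
Definition transpose t : lmodType A^c := quotient_module (im (dual_map (d t))).
Let pi t : {linear D t.+1 -> transpose t} := quotient_map (im (dual_map (d t))).

Lemma transpose_fg t : fg (transpose t).
Proof. exact: fg_surj (@quotient_map_surj _ _ _) (ch_G_dual_fg _). Qed.

(** Vanishing of Ext^t is exactness of the dual complex at [D t.+1], so the cokernel [transpose t]
    embeds in [D t.+2]. *)
Lemma transpose_ses t : ext_vanish c t (A^o : lmodType A) ->
  exists i : {linear transpose t -> D t.+2},
    ses i (pi t.+1) /\ forall f, i (pi t f) = dual_map (d t.+1) f.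
Proof.
move=> E; have [f|i iP] := @factor_surj _ _ _ _ (pi t) (dual_map (d t.+1))
    (@quotient_map_surj _ _ _).
  move=> /quotient_map_eq0; rewrite in_im => /asboolP[g <-].
  by apply: dual_ext => x; rewrite -[LHS]/(dual_linear g (d t (d t.+1 x))) ch_d2 linear0.
exists i; split=> //; split; last 1 first.
- move=> y; rewrite quotient_map_eq0 in_im; split=> [/asboolP[f <-]|[x <-]].
    by exists (pi t f); rewrite iP.
  by have [f <-] := quotient_map_surj x; apply/asboolP; exists f; rewrite -iP.
- move=> x; have [f <-] := quotient_map_surj x; rewrite [i _]iP => f0.
  apply/quotient_map_eq0; rewrite in_im; apply/asboolP.
  have [_ pL iL] := ch_ses c t; have [_ pL' _] := ch_ses c t.+1.
  have [y /iL[l <-]|h hP] := @factor_surj _ _ _ _ (ch_p c t) (dual_linear f) pL.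
    have [z <-] := pL' l.
    by rewrite -[LHS]/(dual_map (d t.+1) f z) f0.
  have [w wP] := E h; exists (dual_of w); apply: dual_ext => y.
  by rewrite /= wP hP.
- exact: quotient_map_surj.
Qed.

Lemma transpose0_inv : exists s : {linear transpose 0%N -> D 1%N}, forall f, s (pi 0%N f) = f.
Proof.
have pi0 f : pi 0%N f = 0 -> f = 0.
  move=> /quotient_map_eq0; rewrite in_im => /asboolP[g <-].
  by apply: dual_ext => x /=; rewrite -[g _]/(dual_linear g _) (ch_G0 (ch_i c 0%N _)) linear0.
have [x|s sP] := @factor_inj _ _ _ _ (pi 0%N) idfun pi0; first exact: quotient_map_surj.
by exists s => f; apply/subr0_eq/pi0; rewrite linearB sP subrr.
Qed.

Lemma transpose_pdle t : (forall k, (k < t)%N -> ext_vanish c k (A^o : lmodType A)) ->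
  pdle t (transpose t).
Proof.
elim: t => [|t IH] E.
  have [s sP] := transpose0_inv; exists (transpose 0%N) => //.
  apply: (@projective_retract _ _ _ (pi 0%N) s (@ch_G_dual_projective 1)) => x.
  by have [f <-] := quotient_map_surj x; rewrite [s _]sP.
have [i [sip _]] := transpose_ses (E t (ltnSn t)).
have [|K nK pK] := IH; first by move=> k kt; apply/E/ltnW.
exists K => //; exists (transpose t), (D t.+2), i, (pi t.+1).
by split=> //; apply: ch_G_dual_projective.
Qed.

(** Descending along [transpose_ses], a smaller projective dimension would make [transpose 1]
    projective and split D 1 -> D 2. Dualizing back, G 2 -> G 1 would be onto and its cokernel
    [ch_L c 0] zero. *)
Lemma transpose_not_pdle t : ~ is_zero_module (ch_L c 0%N) ->
  (forall k, (k <= t)%N -> ext_vanish c k (A^o : lmodType A)) ->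
  ~ pdle t (transpose t.+1).
Proof.
move=> nz; elim: t => [|t IH] E pd; last first.
  have [i [sip _]] := transpose_ses (E t.+1 (leqnn _)).
  apply: IH; first by move=> k kt; apply/E/leqW.
  exact: pdle_ses (@ch_G_dual_projective _) sip pd.
have [i [sip iP]] := transpose_ses (E 0%N (leqnn _)).
have [r rP] := ses_split sip (pdle_syz pd erefl).
have [s sP] := transpose0_inv.
apply: nz => y; have [_ pL _] := ch_ses c 0%N; have [x <-] := pL y.
(* Evaluation at [x] after the splitting is a functional on [D 2], hence evaluation at some [x'];
   then no functional separates [x] from [d 1 x']. *)
have lev : linear (fun f : D 2%N => s (r f) x : (A^c)^o) by move=> a f g; rewrite !linearP.
have [x' x'P] := row_reflexive (rowG 2%N) (linear_of lev).
suff -> : x = d 1%N x' by rewrite /= (ses_comp0 _ (ch_ses c 0%N)).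
apply/subr0_eq/(row_separated (rowG 1%N)) => f.
rewrite -[f _]/(dual_linear f _) linearB /= -[X in _ - X]/(dual_map (d 1%N) f x').
by rewrite -x'P /= -iP rP sP subrr.
Qed.
End Transpose.
End Duals.

(** * The map from S to the double Ext module *)

Section ExtFg.
Context {A : pzRingType}.
Hypotheses (nA : @noetherian A) (nB : @noetherian A^c).

(** With [coboundary_factor] this presents Ext^j(S, A) as the maps on the [j]-th syzygy modulo those
    that extend to [free_chain_G S j]. *)
Lemma cocycle_factor (S : lmodType A) j (z : dual (free_res_mod S j)) :
  z \in cocycles (free_resolution S) j ->
  exists f : {linear syzygy S j -> A^o}, forall x, f (free_cover (syzygy S j) x) = z x.
Proof.
move=> zZ; have [x|f fP] := @factor_surj _ _ _ _ (free_cover (syzygy S j))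
    (dual_linear z) (@free_cover_surj A _); last by exists f.
move=> /eqP; rewrite -in_ker free_res_exact_aux in_im => /asboolP[y <-].
have /eqP z0 := zZ.
by rewrite -[LHS]/(dual_map (free_res_d S j) z y) z0.
Qed.

Lemma coboundary_factor (S : lmodType A) j (z : dual (free_res_mod S j))
    (g : {linear free_chain_G S j -> A^o}) :
  (forall x, z x = g (free_chain_i S j (free_cover (syzygy S j) x))) ->
  z \in coboundaries (free_resolution S) j.
Proof.
case: j z g => [|j] z g zE.
  by apply/eqP/dual_ext => x; rewrite zE linear0.
by rewrite in_im; apply/asboolP; exists (dual_of g); apply: dual_ext => x; rewrite zE.
Qed.

(** [Ext] is computed from a resolution of infinite rank; comparison with one of finite rank makes
    it a quotient of the dual of a finitely generated syzygy. *)
Lemma Ext_fg (S : lmodType A) j : fg S -> fg (Ext S j).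
Proof.
move=> fS; pose c := fg_chain nA (exist _ S fS).
have [a [b [s abE]]] :=
  @chain_compare A (free_chain S) c idfun idfun (fun=> erefl) j.
pose cov := free_cover (syzygy S j).
pose h (f : dual (ch_L c j)) : dual (free_res_mod S j) := dual_map (a \o cov) f.
have hZ f : h f \in cocycles (free_resolution S) j.
  rewrite in_ker; apply/eqP/dual_ext => x /=.
  suff -> : cov (free_res_d S j x) = 0 by rewrite -[f _]/(dual_linear f _) !linear0.
  by apply/eqP; rewrite -in_ker free_res_exact_aux in_im; apply/asboolP; exists x.
have lh : linear (fun f => Submodule (hZ f) : submodule (cocycles (free_resolution S) j)).
  by move=> r f g; apply: val_inj; apply: dual_ext.
pose q := quotient_map (restr (cocycles (free_resolution S) j)
                              (coboundaries (free_resolution S) j)).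
apply: (@fg_surj _ _ _ (q \o linear_of lh)) (dual_fg nB (fg_chain_L _ _ j)) => y.
have [z <-] := quotient_map_surj y; have [f fP] := cocycle_factor (valP z).
(* By [abE], f - f b a factors through [free_chain_i S j], so it gives a coboundary. *)
exists (dual_of (f \o b)); apply/quotient_projP.
rewrite -[_ \in _]/(h (dual_of (f \o b)) - val z \in coboundaries (free_resolution S) j).
rewrite -opprB -scaleN1r rpredZ //.
apply: (@coboundary_factor S j _ (f \o s)) => x.
by rewrite dual_funD -fP {1}[free_cover _ x]abE linearD /= addrAC subrr add0r.
Qed.
End ExtFg.

Section Pairing.
Context {A : pzRingType}.
Variables (S : lmodType A) (j : nat) (c : chain (R := A^c)).
Variable e : {linear ch_L c 0%N -> Ext S j}.
Hypothesis e_surj : forall y, exists x, e x = y.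
Hypothesis Ext_lt : forall t, (t < j)%N -> is_zero_module (Ext S t).
Hypothesis Ext_j : ~ is_zero_module (Ext S j).
Hypothesis ExtE_lt : forall t, (t < j)%N -> ext_vanish c t ((A^c)^o : lmodType A^c).

Local Notation P := (free_res_mod S).
Local Notation d := (free_res_d S).
Local Notation G := (ch_G c).
Local Notation i := (ch_i c).
Local Notation p := (ch_p c).
Local Notation cob := (coboundaries (free_resolution S)).

(* Maps Q_t -> Hom(P_s, A) with s + t = j, where Q and P resolve E = Ext^j(S, A)
   and S, up to the homotopies of the complex Hom(Q, Hom(P, A)): the classes for
   t = 0 and for t = j are maps E -> E and S -> Ext^j(E, A). *)
Definition pairing_cycle s t (g : {linear G t.+1 -> dual (P s)}) :=
  (exists w : {linear G t -> dual (P s.+1)},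
    forall q, dual_map (d s) (g q) = w (i t (p t q))) /\
  forall l, g (i t.+1 l) \in cob s.

Definition pairing_trivial s t (g : {linear G t.+1 -> dual (P s)}) :=
  exists w : {linear G t -> dual (P s)}, forall q, g q - w (i t (p t q)) \in cob s.

Lemma dual_map_d2 s f : dual_map (d s.+1) (dual_map (d s) f) = 0.
Proof.
apply: dual_ext => x; suff E : d s (d s.+1 x) = 0.
  by rewrite -[LHS]/(dual_linear f (d s (d s.+1 x))) E linear0.
apply/eqP; rewrite -in_ker (@free_res_exact A S s) in_im.
by apply/asboolP; exists x.
Qed.

Lemma coboundary_cocycle s z : z \in cob s -> dual_map (d s) z = 0.
Proof.
case: s z => [|s] z; first by move=> /eqP->; rewrite linear0.
by rewrite in_im => /asboolP[f <-]; apply: dual_map_d2.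
Qed.

Lemma p_i0 t l : p t (i t.+1 l) = 0.
Proof. exact: ses_comp0 (ch_ses c t). Qed.

(** One step of the zigzag in Hom(Q, Hom(P, A)): [g] after the differential of Q takes values in
    coboundaries and lifts through that of Hom(P, A). On syzygies the lift takes cocycle values,
    which are coboundaries since Ext^s(S, A) = 0. *)
Lemma pairing_up s t (g : {linear G t.+1 -> dual (P s.+1)}) : (s < j)%N ->
  pairing_cycle g ->
  exists g' : {linear G t.+2 -> dual (P s)}, pairing_cycle g' /\
    forall q, dual_map (d s) (g' q) = g (i t.+1 (p t.+1 q)).
Proof.
move=> sj [_ gB].
have [q|g' g'P] := @projective_lift _ _ _ _ (g \o i t.+1 \o p t.+1)
    (dual_map (d s)) (@ch_projective _ c t.+2).
  by have := gB (p t.+1 q); rewrite in_im => /asboolP.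
exists g'; split=> //; split=> [|l]; first by exists g.
apply: (subquotient_eq0 (Ext_lt sj)); rewrite in_ker; apply/eqP.
by rewrite [LHS]g'P /= p_i0 !linear0.
Qed.

(** If [w] trivializes [g'], then g - d w descends to the [t]-th syzygy of E, and extends from there
    because Ext^t(E, A) = 0. *)
Lemma pairing_down s t (g : {linear G t.+1 -> dual (P s.+1)})
    (g' : {linear G t.+2 -> dual (P s)}) : (t < j)%N ->
  (forall q, dual_map (d s) (g' q) = g (i t.+1 (p t.+1 q))) ->
  pairing_trivial g' -> pairing_trivial g.
Proof.
move=> tj gg' [w wP].
pose del : {linear G t.+1 -> dual (P s.+1)} := g \- (dual_map (d s) \o w).
have [_ pL iL] := ch_ses c t; have [_ pL' _] := ch_ses c t.+1.
have [x /iL[l <-]|f fP] := @factor_surj _ _ _ _ (p t) del pL.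
  have [q <-] := pL' l; rewrite /del /= -gg' -linearB.
  exact: coboundary_cocycle.
have [x|w' w'P] := @extend_dual_free _ _ _ _ (i t) f.
  have lx : linear (fun l => f l (free_delta x) : (A^c)^o) by move=> a u v; rewrite linearP.
  exact: (ExtE_lt tj (linear_of lx)).
exists w' => q; rewrite w'P fP /del /= subKr in_im.
by apply/asboolP; exists (w q).
Qed.

Lemma pairing_descend s t (g : {linear G t.+1 -> dual (P s)}) : (s + t = j)%N ->
  pairing_cycle g -> ~ pairing_trivial g ->
  exists g' : {linear G j.+1 -> dual (P 0%N)}, pairing_cycle g' /\ ~ pairing_trivial g'.
Proof.
elim: s t g => [|s IH] t g stj gZ gN; first by rewrite add0n in stj; subst t; exists g.
have sj : (s < j)%N by rewrite -stj addSn ltnS leq_addr.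
have tj : (t < j)%N by rewrite -stj addSn ltnS leq_addl.
have [g' [g'Z gg']] := pairing_up sj gZ.
apply: (IH t.+1 g') => //; first by rewrite addnS.
by move=> /(pairing_down tj gg').
Qed.

(** The class of [e] itself: lift Q_0 -> Ext^j(S, A) to cocycles. As [G 0] is zero, triviality would
    force Ext^j(S, A) = 0. *)
Lemma pairing_start :
  exists g : {linear G 1%N -> dual (P j)}, pairing_cycle g /\ ~ pairing_trivial g.
Proof.
pose q := quotient_map (restr (cocycles (free_resolution S) j) (cob j)).
have [h hP] := @ch_projective _ c 1%N _ _ q (e \o p 0%N) (@quotient_map_surj _ _ _).
exists (val \o h); split; first split.
- by exists \0 => x; apply/eqP; rewrite /= -in_ker; apply: (valP (h x)).
- move=> l; apply/(quotient_map_eq0 (restr (cocycles (free_resolution S) j) (cob j)) (h _)).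
  by rewrite [LHS]hP /= p_i0 linear0.
- move=> [w wP]; apply: Ext_j => y; have [x <-] := e_surj y.
  have [_ pL _] := ch_ses c 0%N; have [u <-] := pL x.
  rewrite -[LHS]hP; apply/quotient_map_eq0; move: (wP u).
  by rewrite (ch_G0 (i 0%N _)) linear0 subr0.
Qed.

(** [y] represents the image of the generator [s] in Ext^j(E, A), and [ext a] says that [a] kills
    its class. Thus the class is nonzero and is killed by the annihilator of [s]. *)
Theorem exists_detecting_map (s : S) : (forall x, exists a, x = a *: s) ->
  exists y : {linear ch_L c j -> (A^c)^o},
    let ext (a : A) := exists w : {linear G j -> (A^c)^o},
      forall l, w (i j l) = a * (y l : A) in
    (forall a, a *: s = 0 -> ext a) /\ ~ ext 1.
Proof.
move=> sS; have [g0 [g0Z g0N]] := pairing_start.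
have [g [[[w wP] gB] gN]] := pairing_descend (addn0 j) g0Z g0N.
have [_ pL iL] := ch_ses c j.
(* In degree 0 the only coboundary is 0, so [g] vanishes on the next syzygy and factors through the
   [j]-th. *)
have [x /iL[l <-]|f fP] := @factor_surj _ _ _ _ (p j) g pL.
  exact/eqP/gB.
have lev (V : lmodType A^c) (U : lmodType A) (h : {linear V -> dual U}) x :
    linear (fun v => h v x : (A^c)^o) by move=> a u v; rewrite linearP.
have [s0 s0E] := @free_cover_surj A S s.
have wE l x : f l (d 0%N x) = w (i j l) x.
  have [q <-] := pL l; rewrite fP -wP //.
have im_d x : free_cover S x = 0 -> exists x', d 0%N x' = x.
  by move=> /eqP; rewrite -in_ker (@free_res_exact_aux A S 0) in_im => /asboolP.
exists (linear_of (lev _ _ f s0)) => ext; split=> [a as0|[w1 w1P]].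
  have [|x xE] := im_d (a *: s0); first by rewrite linearZ_LR /= s0E.
  exists (linear_of (lev _ _ w x)) => l /=; rewrite -wE xE.
  exact: (linearZ_LR (dual_linear (f l))).
apply: gN.
have [x|w' w'P] := @extend_dual_free _ _ _ _ (i j) f.
  (* Each basis element of P_0 is [a *: s0] plus a boundary, so an extension of [y] would give one
     of every coordinate of [f], and [g] would be trivial. *)
  have [a aE] := sS (free_cover S (free_delta x)).
  have [|x' x'E] := im_d (free_delta x - a *: s0).
    by rewrite linearB linearZ_LR /= s0E -aE subrr.
  have lw : linear (fun v => (a * (w1 v : A) + w v x' : A) : (A^c)^o).
    move=> b u v; rewrite !linearP /= mulrDr addrACA.
    by rewrite -[b *: w1 u]/((w1 u : A) * b) mulrA -mulrDl.
  exists (linear_of lw) => l /=; rewrite w1P mul1r -wE x'E.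
  rewrite -[X in _ + X]/(dual_linear (f l) _) linearB linearZ_LR /=.
  by rewrite addrC subrK.
exists w' => q; rewrite w'P fP subrr; exact: rpred0.
Qed.
End Pairing.

(** * The finitistic dimension *)

Lemma rad_rinv (R : pzRingType) (a : R) : rad a -> forall b, exists u, (1 - a * b) * u = 1.
Proof.
move=> aJ b; have [u [_ uP]] := rad_unit (radMl b aJ).
exists (1 + a * u * b).
have K : (1 - a * b) * (a * u * b) = a * ((1 - b * a) * u) * b.
  by rewrite mulrBl mul1r [(1 - b * a) * u]mulrBl mul1r mulrBr mulrBl !mulrA.
by rewrite mulrDr mulr1 K uP mulr1 subrK.
Qed.

(** Left-right symmetry of the radical: over [R^c] the definition asks for right inverses of
    [1 - a * b]. *)
Lemma rad_conv (R : pzRingType) (a : R) : @rad R a <-> @rad R^c a.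
Proof. by split=> [/rad_rinv|/(@rad_rinv R^c)]. Qed.

Section SimpleQuotient.
Context {A : pzRingType}.
Variable e : A.
Hypotheses (me : rad_min e) (nJe : ~ rad e).

Fact simple_ann_submod : is_submod (V := A^o) (fun a => rad (a * e)).
Proof.
split=> [|a b aJ bJ|a b bJ].
- by rewrite mul0r; apply: (submod0 (@rad_submod A)).
- by rewrite mulrDl; apply: (submodD (@rad_submod A) aJ bJ).
- by rewrite -[a *: b]/(a * b) -mulrA; apply: radMl.
Qed.

(** A copy of (A e + J) / J with J the radical, the class of 1 corresponding to that of [e]. *)
Definition simple_quotient : lmodType A := quotient_module (submod_of simple_ann_submod).
Definition simple_gen : simple_quotient := quotient_proj _ (1 : A^o).

Lemma simple_genZ (a : A) : a *: simple_gen = quotient_proj _ (a : A^o).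
Proof. by rewrite /simple_gen -[LHS]quotient_projZ -[a *: (1 : A^o)]/(a * 1) mulr1. Qed.

Lemma simple_gen_span x : exists a, x = a *: simple_gen.
Proof.
have [a <-] := quotient_map_surj x; exists a; exact/esym/simple_genZ.
Qed.

Lemma simple_gen_ann (a : A) : a *: simple_gen = 0 <-> rad (a * e).
Proof.
rewrite simple_genZ (quotient_map_eq0 (submod_of simple_ann_submod)).
exact: in_submod_of.
Qed.

Lemma simple_quotient_simple : simple_module simple_quotient.
Proof.
split=> [zS|N].
  by apply: nJe; rewrite -[e]mul1r; apply/simple_gen_ann; apply: zS.
have [[x [xN x0]]|no] := pselect (exists x, x \in N /\ x <> 0); [right|left] => y.
  have [a xE] := simple_gen_span x.
  have [aJ|[b bJ]] := me a; first by case: x0; rewrite xE; apply/simple_gen_ann.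
  have bx : b *: x = simple_gen.
    apply/subr0_eq; rewrite xE scalerA -[X in _ - X]scale1r -scalerBl.
    by apply/simple_gen_ann; rewrite mulrBl mul1r.
  by have [c ->] := simple_gen_span y; rewrite -bx; do 2! apply: rpredZ.
apply/idP/eqP => [yN|->]; last exact: rpred0.
by apply: contrapT => y0; apply: no; exists y.
Qed.

Lemma simple_quotient_fg : fg simple_quotient.
Proof.
apply: (@span_fg _ _ [:: simple_gen]) => x; have [a ->] := simple_gen_span x.
by apply/spanZ/span_mem; rewrite inE eqxx.
Qed.
End SimpleQuotient.

Section Coordinates.
Context {A : pzRingType}.
Variables (c : chain (R := A^c)) (j : nat) (ann : A -> Prop).
Variable y : {linear ch_L c j -> (A^c)^o}.
Let ext (a : A) := exists w : {linear ch_G c j -> (A^c)^o},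
  forall l, w (ch_i c j l) = a * (y l : A).
Hypothesis ext_ann : forall a, ext a <-> ann a.
Hypothesis rad_ann : forall a, rad a -> ann a.

(** The class of [y] times [q] becomes zero in Ext^j(E, P), because [i q] is a combination with
    radical coefficients and these kill [y]. By [ext_vanish_inj] it is zero in Ext^j(E, K) already,
    and applying [f] shows that [f q] kills [y]. *)
Lemma coord_ann (K P M : lmodType A^c) (i : {linear K -> P}) (p : {linear P -> M})
    (f : {linear K -> (A^c)^o}) q :
  ses i p -> (forall t, j = t.+1 -> ext_vanish c t M) ->
  rad_pow 1 (i q) -> ann (f q).
Proof.
move=> sip EM iqJ.
have [w wP] : exists w : {linear ch_G c j -> P},
    forall l, w (ch_i c j l) = (y l : A^c) *: i q.
  suff H v : rad_pow 1 v -> forall a : A^c, exists w : {linear ch_G c j -> P},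
      forall l, w (ch_i c j l) = ((y l : A^c) * a) *: v.
    by have [w wP] := H _ iqJ 1; exists w => l; rewrite wP mulr1.
  elim=> [_ [b [x [bJ _ ->]]]||u v' _ IHu _ IHv|b u _ IHu] a.
  - have /ext_ann[w wP] : ann (a * b : A^c).
      by apply/rad_ann/rad_conv/radMl.
    have lw : linear (fun g => (w g : A^c) *: x).
      by move=> r g h; rewrite linearP scalerDl scalerA.
    exists (linear_of lw) => l /=; rewrite wP scalerA; congr (_ *: _).
    exact: mulrA.
  - by exists \0 => l; rewrite scaler0.
  - have [wu wuP] := IHu a; have [wv wvP] := IHv a.
    by exists (wu \+ wv) => l /=; rewrite wuP wvP scalerDr.
  - have [w wP] := IHu (a * b); exists w => l.
    by rewrite wP scalerA mulrA.
have lq : linear (fun l => (y l : A^c) *: q).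
  by move=> r l l'; rewrite linearP scalerDl scalerA.
have [|w' w'P] := @ext_vanish_inj _ c j _ _ _ i p (linear_of lq) w sip EM.
  by move=> l; rewrite wP linearZ_LR.
apply/ext_ann; exists (f \o w') => l /=; rewrite w'P /= linearZ_LR //.
Qed.
End Coordinates.

(** * Grades of simple modules and bounds on projective dimension *)

Section Main.
Context {A : pzRingType}.
Hypotheses (artA : artinian_module (A^o : lmodType A))
           (artB : artinian_module ((A^c)^o : lmodType A^c)).
Hypothesis grade_condition : forall S : lmodType A,
  finitely_presented S -> simple_module S ->
  forall jS : nat, grade S = Some jS ->
  forall j : nat, (j < jS)%N -> is_zero_module (Ext (Ext S jS) j).
Variable b : nat.
Hypothesis findim_le : forall (M : lmodType A^c) n,
  finitely_presented M -> projdim M = Some n -> (n <= b)%N.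

Let nA := artinian_noetherian artA.
Let nB := artinian_noetherian artB.

Lemma grade_le (S : lmodType A) : fg S -> ~ is_zero_module S ->
  exists2 j, grade S = Some j & (j <= b)%N.
Proof.
move=> fS nzS.
have [n nb nE] : exists2 n, (n <= b)%N & ~ is_zero_module (Ext S n).
  apply: contrapT => no.
  have zE n : (n <= b)%N -> is_zero_module (Ext S n).
    by move=> nb; apply: contrapT => nz; apply: no; exists n.
  pose c := fg_chain nA (exist _ S fS).
  have cE n : (n <= b)%N -> ext_vanish c n (A^o : lmodType A).
    by move=> /zE/Ext_vanish; apply: (@ext_vanish_transfer _ c (free_chain S) idfun idfun).
  have rowG := @fg_chain_row _ nA (exist _ S fS).
  (* Vanishing in degrees 0 to [b] gives a finitely presented module of projective dimension exactly
     [b.+1], contradicting [findim_le]. *)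
  have : projdim (transpose c b.+1) = Some b.+1.
    apply/projdimP; split; first exact: transpose_pdle.
    move=> m pm; rewrite ltnNge; apply/negP => mb.
    exact: (transpose_not_pdle rowG nzS cE (pdle_leq mb pm)).
  move=> /findim_le; rewrite ltnn => H.
  by have := H (noetherian_fp nB (transpose_fg rowG _)).
have ex : exists n, `[< ~ is_zero_module (Ext S n) >] by exists n; apply/asboolP.
have [j /asboolP jE jmin] := ex_minnP ex; exists j; last first.
  by apply: leq_trans nb; apply/jmin/asboolP.
by apply/inf_natP; split=> // m mE; apply/jmin/asboolP.
Qed.

Lemma high_syzygy_projective n (M K P Q : lmodType A^c) (i : {linear Q -> P})
    (p : {linear P -> K}) :
  (b <= n)%N -> syz n M K -> projective Q -> projective P -> ses i p -> projective K.
Proof.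
move=> bn nK pQ pP sip.
(* For [e] outside the radical, this says that coordinates of [q] annihilate the simple module
   generated by the class of [e]. *)
have annE (e : A) q (f : {linear Q -> (A^c)^o}) : rad_min e -> rad_pow 1 (i q) ->
    rad ((f q : A) * e).
  move=> me qJ; have [eJ|nJe] := pselect (rad e); first exact: radMl.
  pose S := simple_quotient e.
  have sS := simple_quotient_simple me nJe.
  have fS := simple_quotient_fg e.
  have [j gj jb] := grade_le fS (proj1 sS).
  have [nzE jmin] := (inf_natP _ _).1 gj.
  have fE : fg (Ext S j) := Ext_fg nA nB j fS.
  have zE t : (t < j)%N -> is_zero_module (Ext S t).
    by move=> tj; apply: contrapT => /jmin; rewrite leqNgt tj.
  pose c := fg_chain nB (exist _ (Ext S j) fE).
  have cE t : (t < j)%N -> ext_vanish c t ((A^c)^o : lmodType A^c).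
    move=> tj; apply: (@ext_vanish_transfer _ c (free_chain (Ext S j)) idfun idfun) => //.
    exact/Ext_vanish/(grade_condition (noetherian_fp nA fS) sS gj).
  have [|y [yann ny]] := @exists_detecting_map A S j c idfun _ zE nzE cE
    (simple_gen e) (@simple_gen_span A e).
    by move=> x; exists x.
  pose ann a := rad (a * e).
  apply: (@coord_ann A c j ann y _ _ Q P K i p f q sip _ qJ) => [a|a aJ|t jt].
  - split=> [[w wP]|/simple_gen_ann/yann //].
    (* If [a] kills the class of [y] but not the simple module, then [a' * a - 1] annihilates the
       generator, and y = a' (a y) - (a' a - 1) y would extend. *)
    have [//|[a' a'J]] := me a; case: ny.
    have [|w' w'P] := yann (a' * a - 1).
      by apply/simple_gen_ann; rewrite mulrBl mul1r.
    have lw : linear (fun g => (a' * (w g : A) - w' g : A) : (A^c)^o).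
      move=> r g h; rewrite (linearP w) (linearP w') mulrDr opprD addrACA; congr (_ + _).
      rewrite -[r *: w g]/((w g : A) * r) -[r *: w' g]/((w' g : A) * r).
      by rewrite mulrA -mulrBl.
    exists (linear_of lw) => l /=; rewrite wP w'P mulrA -mulrBl subKr //.
  - exact: radMr.
  - have tj : (t < j)%N by rewrite jt.
    (* The bound on the grade enters here: [t < j <= b <= n]. *)
    apply: (@ext_vanish_syz _ c j n M K _ nK) => // [k P' kj pP'|].
      exact: ext_vanish_projective (fg_chain_L _ _ k) (cE k kj) pP'.
    exact: leq_trans tj (leq_trans jb bn).
have coordJ q (f : {linear Q -> (A^c)^o}) : rad_pow 1 (i q) -> @rad A^c (f q).
  move=> qJ; apply/rad_conv.
  have [x xS xJ] := rad_min_span artA.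
  pose z : A := f q; change (rad z); rewrite -[z]mulr1 -{1}(subrK x 1) mulrDr.
  apply: (submodD (@rad_submod A)); first exact: radMl.
  (* The factor [r] absorbs the scalars of the span; [z * r] is the coordinate of [r *: q]. *)
  have {xJ}: forall r : A, rad (z * r * x); last by move/(_ 1); rewrite mulr1.
  elim: xS => [e me||u v _ IHu _ IHv|a u _ IHu] r.
  - have := @annE e ((r : A^c) *: q) f me; rewrite !linearZ_LR; apply.
    exact: (submodZ (rad_pow_submod 1 P)).
  - by rewrite mulr0; apply: (submod0 (@rad_submod A)).
  - by rewrite mulrDr; apply: (submodD (@rad_submod A)).
  - by rewrite -[a *: u]/(a * u) mulrA -[_ * r * a]mulrA.
have [q qJ|r rP] := split_mod_rad artB (i := i) pP.
  (* As a summand of a free module, [Q] has [q] as a combination with its coordinates as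
     coefficients, and these lie in the radical. *)
  have [s sK] := projective_section pQ.
  have [S [us su]] := free_supp (s q).
  rewrite (etrans (esym (sK q)) (free_liftE _ us su)); apply: big_ind => [|x1 x2|x _].
  - exact: (submod0 (rad_pow_submod 1 Q)).
  - exact: (submodD (rad_pow_submod 1 Q)).
  - have lx : linear (fun q => free_coef (s q) x : (A^c)^o) by move=> a u v; rewrite linearP.
    by apply: rad_pow_scale => //; apply: (coordJ q (linear_of lx)).
have [i0 pS ip] := sip.
have [x /ip[k <-]|s sP] := @factor_surj _ _ _ _ p (idfun \- (i \o r)) pS.
  by rewrite /= rP subrr.
apply: (@projective_retract _ P K p s) => // x; have [u <-] := pS x.
by rewrite sP /= linearB (ses_comp0 _ sip) subr0.
Qed.

(** While the bound [n.+1] exceeds [b], the [n]-th syzygy has a projective presentation of length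
    one, so it is projective by [high_syzygy_projective] and the bound drops to [n]. *)
Lemma Findim_le (M : lmodType A^c) n : projdim M = Some n -> (n <= b)%N.
Proof.
move=> /projdimP[Mn nmin]; apply: nmin.
have [nb|] := leqP n b; first exact: pdle_leq nb Mn.
elim: n Mn => // n IH Mn; rewrite ltnS => bn.
have {}Mn : pdle n M.
  have [Q nQ pQ] := Mn.
  have [K [P [i [p [nK pP sip]]]]] := syz_belast nQ.
  by exists K => //; apply: high_syzygy_projective nK pQ pP sip.
move: bn; rewrite leq_eqVlt => /predU1P[-> //|]; exact: IH.
Qed.
End Main.

(** [(R^c)^c] has the operations of [R] but is another structure, so submodules are carried over
    through their predicates. *)
Lemma artinian_conv2 (R : pzRingType) : artinian_module (R^o : lmodType R) ->
  artinian_module (((R^c)^c)^o : lmodType (R^c)^c).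
Proof.
move=> artR I Idec.
have sI n : is_submod (V := R^o) (fun x => x \in I n).
  have [h0 hD hZ] := submodClosedP (I n); split=> //; exact: hZ.
have [n x|m mP] := artR (fun n => submod_of (sI n)).
  by move=> /in_submod_of/Idec xI; apply/in_submod_of.
exists m => n mn x; have xE := mP n mn x.
apply/idP/idP => xI.
- by apply: (in_submod_of (sI m) x).1; rewrite -xE; apply: (in_submod_of (sI n) x).2.
- by apply: (in_submod_of (sI n) x).1; rewrite xE; apply: (in_submod_of (sI m) x).2.
Qed.

Theorem corollary2p13 (Lambda : pzRingType) (artL : artinian_ring Lambda)
  (grade_condition : forall S : Mod Lambda,
     finitely_presented S -> simple_module S ->
     forall jS : nat, grade S = Some jS ->
     forall j : nat, (j < jS)%N -> is_zero_module (Ext (Ext S jS) j)) :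
  findim Lambda^c = Findim Lambda^c.
Proof.
case: artL => /artinian_conv2 artB artA.
(* Each supremum is the least element of a set of upper bounds, so equality of these sets also
   settles the infinite case. *)
congr inf_nat; apply/seteqP; split=> b /= bP n.
- move=> [M Mn]; apply: (Findim_le artA artB grade_condition _ Mn) => M' n' fM' M'n'.
  by apply: bP; exists M'.
- by move=> [M _ Mn]; apply: bP; exists M.
Qed.
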